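(* Let $A$ be an Artin group whose Artin presentation graph is connected, and suppose that $A$ is not isomorphic to $\mathbb Z$. Then $A$ is not relatively hyperbolic.
   Context: An Artin group is $A=\langle x_1,\dots,x_n\mid (x_i,x_j)_{m_{ij}}=(x_j,x_i)_{m_{ij}},\ i\ne j\rangle$, $n\ge1$, where $m_{ij}=m_{ji}\in\{2,3,\dots,\infty\}$, $(x_i,x_j)_m$ is the alternating word $x_ix_jx_i\cdots$ with $m$ letters if $m<\infty$, and there is no relation between $x_i$ and $x_j$ if $m_{ij}=\infty$. Its Artin presentation graph has vertices $1,\dots,n$ and an edge labelled $m_{ij}$ between $i$ and $j$ whenever $m_{ij}<\infty$. ''Hyperbolic relative to'' means strongly hyperbolic relative to a finite collection of finitely generated subgroups (in the sense of Farb: weakly relatively hyperbolic together with the bounded coset penetration property). An infinite finitely generated group is relatively hyperbolic if it is hyperbolic relative to some finite collection of proper finitely generated subgroups (in particular, infinite hyperbolic groups are relatively hyperbolic, relative to the trivial subgroup); otherwise it is ''not relatively hyperbolic''. *)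

(* Defs.v *)
From HB Require Import structures.
From mathcomp Require Import all_boot all_order all_algebra.
From mathcomp Require Import boolp classical_sets.

Set Implicit Arguments.
Unset Strict Implicit.
Unset Printing Implicit Defensive.

Local Open Scope quotient_scope.
Local Open Scope classical_set_scope.
Local Open Scope group_scope.

(* ** Groups given by generators and relations *)

(* The letter (x, b) stands for x if b is false and for x^-1 if b is true. *)
Definition gword (X : choiceType) := seq (X * bool).

(* The congruence on words whose quotient is < X | r = s for (r, s) in R >. *)
Inductive pres_eq (X : choiceType) (R : gword X -> gword X -> Prop) :
    gword X -> gword X -> Prop :=
| pres_refl u : pres_eq R u u
| pres_sym u v : pres_eq R u v -> pres_eq R v u
| pres_trans u v w : pres_eq R u v -> pres_eq R v w -> pres_eq R u w
| pres_cancel u x b v : pres_eq R (u ++ [:: (x, b); (x, ~~ b)] ++ v) (u ++ v)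
| pres_rel u r s v : R r s -> pres_eq R (u ++ r ++ v) (u ++ s ++ v).

Section PresentedGroup.
Variables (X : choiceType) (R : gword X -> gword X -> Prop).
Implicit Types u v w : gword X.

Definition pres_eqb : rel (gword X) := fun u v => `[< pres_eq R u v >].

Fact pres_eqb_equiv : equiv_class_of pres_eqb.
Proof.
split=> [u|u v|v u w].
- exact/asboolP/pres_refl.
- by apply/asboolP/asboolP; apply: pres_sym.
- by move=> /asboolP uv /asboolP vw; apply/asboolP/(pres_trans uv vw).
Qed.

Canonical pres_equiv := EquivRelPack pres_eqb_equiv.

Definition presented_group := {eq_quot pres_equiv}.
HB.instance Definition _ := Choice.on presented_group.
HB.instance Definition _ := EqQuotient.on presented_group.

Definition pres_class u : presented_group := \pi_presented_group u.

Lemma pres_classP u v : pres_class u = pres_class v <-> pres_eq R u v.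
Proof.
split=> [/eqP|uv]; first by rewrite piE => /asboolP.
by apply/eqP; rewrite piE; apply/asboolP.
Qed.

Lemma pres_classK x : pres_class (repr x) = x.
Proof. exact: reprK. Qed.

Definition gword_inv u : gword X := rev [seq (a.1, ~~ a.2) | a <- u].

Definition pres_one := pres_class [::].
Definition pres_mul (x y : presented_group) := pres_class (repr x ++ repr y).
Definition pres_inv (x : presented_group) := pres_class (gword_inv (repr x)).

Lemma gword_inv_cat u v : gword_inv (u ++ v) = gword_inv v ++ gword_inv u.
Proof. by rewrite /gword_inv map_cat rev_cat. Qed.

Lemma gword_invK : involutive gword_inv.
Proof.
move=> u; rewrite /gword_inv map_rev revK -map_comp map_id_in // => -[x b] _.
by rewrite /= negbK.
Qed.

Lemma pres_eq_catl w u v : pres_eq R u v -> pres_eq R (w ++ u) (w ++ v).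
Proof.
elim=> {u v} [u|u v _|u v t _ uv _|u x b v|u r s v rs].
- exact: pres_refl.
- exact: pres_sym.
- exact: pres_trans uv.
- rewrite !(catA w); exact: pres_cancel.
- rewrite !(catA w); exact: pres_rel.
Qed.

Lemma pres_eq_catr w u v : pres_eq R u v -> pres_eq R (u ++ w) (v ++ w).
Proof.
elim=> {u v} [u|u v _|u v t _ uv _|u x b v|u r s v rs].
- exact: pres_refl.
- exact: pres_sym.
- exact: pres_trans uv.
- rewrite -!catA; exact: pres_cancel.
- rewrite -!catA; exact: pres_rel.
Qed.

Lemma pres_eq_mulV u : pres_eq R (u ++ gword_inv u) [::].
Proof.
elim/last_ind: u => [|u [x b] IH]; first exact: pres_refl.
rewrite -cats1 gword_inv_cat -catA; apply: pres_trans IH.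
exact: (pres_cancel R u x b).
Qed.

Lemma pres_repr u : pres_eq R (repr (pres_class u)) u.
Proof. by apply/pres_classP; rewrite pres_classK. Qed.

Lemma pres_mulE u v : pres_mul (pres_class u) (pres_class v) = pres_class (u ++ v).
Proof.
apply/pres_classP/(pres_trans (pres_eq_catr _ (pres_repr u))).
exact/pres_eq_catl/pres_repr.
Qed.

Fact pres_mulA : associative pres_mul.
Proof.
move=> x y z; rewrite -(pres_classK x) -(pres_classK y) -(pres_classK z).
by rewrite !(pres_mulE, catA).
Qed.

Fact pres_mul1 : left_id pres_one pres_mul.
Proof. by move=> x; rewrite -(pres_classK x) pres_mulE. Qed.

Fact pres_mulr1 : right_id pres_one pres_mul.
Proof. by move=> x; rewrite -(pres_classK x) pres_mulE cats0. Qed.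

Fact pres_mulVx : left_inverse pres_one pres_inv pres_mul.
Proof.
move=> x; rewrite -{2}(pres_classK x) pres_mulE; apply/pres_classP.
by rewrite -{2}(gword_invK (repr x)); apply: pres_eq_mulV.
Qed.

Fact pres_mulxV : right_inverse pres_one pres_inv pres_mul.
Proof.
move=> x; rewrite -{1}(pres_classK x) pres_mulE.
exact/pres_classP/pres_eq_mulV.
Qed.

HB.instance Definition _ := isGroup.Build presented_group
  pres_mulA pres_mul1 pres_mulr1 pres_mulVx pres_mulxV.

End PresentedGroup.

(* ** Artin groups *)

(* The off-diagonal entries m i j are the labels, None standing for infinity;
   the diagonal entries are never used. *)
Definition artin_labels (n : nat) (m : 'I_n -> 'I_n -> option nat) :=
  forall i j : 'I_n, i != j ->
    m i j = m j i /\ (forall k, m i j = Some k -> 2 <= k).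

Fixpoint alternating (n : nat) (i j : 'I_n) (k : nat) : gword 'I_n :=
  if k is k'.+1 then (i, false) :: alternating j i k' else [::].

Definition artin_relation (n : nat) (m : 'I_n -> 'I_n -> option nat)
    (r s : gword 'I_n) :=
  exists i j k, [/\ i != j, m i j = Some k,
    r = alternating i j k & s = alternating j i k].

Definition artin_group (n : nat) (m : 'I_n -> 'I_n -> option nat) : groupType :=
  presented_group (artin_relation m).

Definition artin_edge (n : nat) (m : 'I_n -> 'I_n -> option nat) : rel 'I_n :=
  fun i j => (i != j) && (m i j != None).

Definition artin_graph_connected (n : nat) (m : 'I_n -> 'I_n -> option nat) :=
  forall i j : 'I_n, connect (artin_edge m) i j.

Definition isomorphic_to_int (G : groupType) :=
  exists2 f : G -> int, bijective f &
    {morph f : x y / (x * y)%g >-> (x + y)%R}.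

(* ** Relatively hyperbolic groups *)

Section RelativeHyperbolicity.
Variable G : groupType.

Definition letter (S : seq G) (a : G) := (a \in S) || (a^-1 \in S).

Definition word_norm_le (S : seq G) (c : nat) (g : G) :=
  exists w : seq G,
    [/\ size w <= c, all (letter S) w & g = \prod_(a <- w) a].

Definition word_dist_le (S : seq G) (c : nat) (x y : G) :=
  word_norm_le S c (x^-1 * y).

Definition generated (S : seq G) : set G :=
  [set g | exists c, word_norm_le S c g].

Definition fg_subgroup (H : set G) :=
  group_closed [in H] /\ exists T : seq G, H = generated T.

Variables (S : seq G) (k : nat) (H : 'I_k -> set G).

(* Vertices of the coned-off Cayley graph: the group elements, and a cone
   vertex Cone i A for each left coset A of H i.  When A is not a left coset
   of H i, Cone i A is an isolated vertex, on no path of positive length. *)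
Inductive cvertex := Elt of G | Cone of 'I_k & set G.

Definition in_cone (x : G) (i : 'I_k) (A : set G) :=
  A = [set x * h | h in H i].

Definition cadj (u v : cvertex) : Prop :=
  match u, v with
  | Elt x, Elt y => letter S (x^-1 * y)
  | Elt x, Cone i A => in_cone x i A
  | Cone i A, Elt x => in_cone x i A
  | Cone _ _, Cone _ _ => False
  end.

(* Edge lengths are doubled so as to be integers: a Cayley edge has length 1
   and an edge to a cone vertex has length 1/2. *)
Definition clen (u v : cvertex) : nat :=
  match u, v with Elt _, Elt _ => 2 | _, _ => 1 end.

(* A path is given by its successive vertices p 0, ..., p l; the values of p
   beyond l are irrelevant. *)
Definition cpath (p : nat -> cvertex) (l : nat) :=
  forall t, t < l -> cadj (p t) (p t.+1).

Definition clength (p : nat -> cvertex) (s t : nat) : nat :=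
  (\sum_(s <= r < t) clen (p r) (p r.+1))%N.

Definition cdist_le (d : nat) (u v : cvertex) :=
  exists p l, [/\ cpath p l, p 0 = u, p l = v & clength p 0 l <= d].

(* (lam, 0)-quasi-geodesics: the length of any subpath is at most lam times
   the distance between its endpoints.  An integral lam is enough, since the
   condition gets weaker as lam grows. *)
Definition quasi_geodesic (lam : nat) (p : nat -> cvertex) (l : nat) :=
  cpath p l /\
  forall s t d, s <= t <= l -> cdist_le d (p s) (p t) ->
    clength p s t <= lam * d.

Definition cgeodesic := quasi_geodesic 1.

Definition near_path (delta : nat) (u : cvertex) (p : nat -> cvertex) (l : nat) :=
  exists2 t, t <= l & cdist_le delta u (p t).

(* Triangles with corners at vertices are enough for hyperbolicity: allowing
   corners inside edges only changes delta. *)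
Definition coned_off_hyperbolic :=
  exists delta : nat,
    forall (p q r : nat -> cvertex) (lp lq lr : nat),
      cgeodesic p lp -> cgeodesic q lq -> cgeodesic r lr ->
      p lp = q 0 -> q lq = r 0 -> r lr = p 0 ->
      forall t, t <= lp ->
        near_path delta (p t) q lq \/ near_path delta (p t) r lr.

Definition penetrates (p : nat -> cvertex) (l : nat) (i : 'I_k) (A : set G)
    (x y : G) :=
  exists t, [/\ t.+2 <= l, p t = Elt x, p t.+1 = Cone i A & p t.+2 = Elt y].

(* No coset is left and then entered again.  A (lam, 0)-quasi-geodesic meets
   no vertex twice, so this follows from quasi_geodesic lam p l; it is kept as
   a hypothesis below to follow the usual wording. *)
Definition without_backtracking (p : nat -> cvertex) (l : nat) :=
  forall s t i A, s <= l -> t <= l ->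
    p s = Cone i A -> p t = Cone i A -> s = t.

Definition bounded_coset_penetration :=
  forall lam : nat, exists c : nat,
  forall (p q : nat -> cvertex) (lp lq : nat) (a b b' : G),
    quasi_geodesic lam p lp -> without_backtracking p lp ->
    quasi_geodesic lam q lq -> without_backtracking q lq ->
    p 0 = Elt a -> q 0 = Elt a -> p lp = Elt b -> q lq = Elt b' ->
    word_dist_le S 1 b b' ->
    forall (i : 'I_k) (A : set G) (x y : G), penetrates p lp i A x y ->
      ((forall x' y', ~ penetrates q lq i A x' y') -> word_dist_le S c x y) /\
      (forall x' y', penetrates q lq i A x' y' ->
         word_dist_le S c x x' /\ word_dist_le S c y y').

End RelativeHyperbolicity.

(* Farb's strong relative hyperbolicity; it does not depend on the choice of
   the finite generating set S. *)
Definition hyperbolic_relative_to (G : groupType) (k : nat)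
    (H : 'I_k -> set G) :=
  exists S : seq G, [/\ generated S = setT,
    coned_off_hyperbolic S H & bounded_coset_penetration S H].

(* Meant for infinite groups.  The case k = 0 is that of hyperbolic groups,
   which are also hyperbolic relative to the trivial subgroup. *)
Definition relatively_hyperbolic (G : groupType) :=
  exists (k : nat) (H : 'I_k -> set G),
    (forall i, fg_subgroup (H i) /\ H i <> setT) /\
    hyperbolic_relative_to H.

(* Main.v *)
Require Import Defs.
From mathcomp Require Import all_boot all_order all_algebra all_field.
From mathcomp Require Import boolp classical_sets.
From mathcomp Require Import zify ring.

(* Every edge {i, j} of the presentation graph provides an element z of positive
   length, the square of the common value of the two alternating words, which
   commutes with x_i and x_j.  Suppose that A is hyperbolic relative to proper
   subgroups H_i, and let z act on the coned-off Cayley graph.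
   If some z has a bounded orbit, bounded coset penetration puts a power of z
   into a conjugate P of some H_i.  Since an element commuting with an element of
   infinite order of P lies in P, connectedness of the graph puts all generators
   into P, and H_i is not proper.
   If z has unbounded orbits, let m be the middle of a long geodesic from 1 to
   z^n.  For the (M+1)^2 elements w = x_i^a x_j^b with a, b <= M, which commute
   with z, the point w m is close to one of O(M) vertices of the geodesic.  Hence
   many of the quotients w'^-1 w move two far apart points of the geodesic by a
   bounded amount, so they cannot all be distinct (acylindricity), and
   x_i^N = x_j^N for some N > 0.  This is refuted by letting A act on pairs
   (r, c): with s_i the reflections of the Coxeter group in the Tits
   representation, x_i maps r to s_i r s_i and adds 1 to c when r = s_i. *)

Set Implicit Arguments.
Unset Strict Implicit.
Unset Printing Implicit Defensive.

(** * Paths in the coned-off graph *)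

Section Paths.
Local Open Scope classical_set_scope.
Local Open Scope group_scope.
Variables (G : groupType) (S : seq G) (k : nat) (H : 'I_k -> set G).
Local Notation V := (cvertex G k).
Local Notation adj := (cadj S H).
Local Notation dle := (cdist_le S H).
Local Notation path := (cpath S H).
Local Notation geod := (cgeodesic S H).
Implicit Types (p q r : nat -> V) (u v w : V) (l s t d : nat) (x y g : G).

Lemma letter_inv a : letter S a -> letter S a^-1.
Proof. by rewrite /letter invgK orbC. Qed.

Lemma cadj_sym u v : adj u v -> adj v u.
Proof. by case: u v => [x|i A] [y|j B] //= /letter_inv; rewrite invgM invgK. Qed.

Lemma clen_sym u v : clen u v = clen v u.
Proof. by case: u v => [x|i A] [y|j B]. Qed.

Lemma clen_bounds u v : 0 < clen u v <= 2.
Proof. by case: u v => [x|i A] [y|j B]. Qed.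

Lemma clengthxx p s : clength p s s = 0.
Proof. by rewrite /clength big_geq. Qed.

Lemma clengthS p s t : s <= t -> clength p s t.+1 = (clength p s t + clen (p t) (p t.+1))%N.
Proof. by move=> st; rewrite /clength big_nat_recr. Qed.

Lemma clength1 p s : clength p s s.+1 = clen (p s) (p s.+1).
Proof. by rewrite clengthS // clengthxx. Qed.

Lemma clengthD p s t n : s <= t -> t <= n -> (clength p s t + clength p t n = clength p s n)%N.
Proof. by move=> st tr; rewrite /clength -big_cat_nat. Qed.

Lemma clength_eq p q s t s' t' : (t - s = t' - s')%N -> s <= t -> s' <= t' ->
  (forall n, n <= t - s -> p (s + n)%N = q (s' + n)%N) -> clength p s t = clength q s' t'.
Proof.
move=> e st st' pq; rewrite /clength -{1}(add0n s) -{1}(add0n s') !big_addn e.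
rewrite !big_mkord; apply: eq_bigr => i _.
have it := ltn_ord i; rewrite (addnC i s) (addnC i s') -!addnS.
by rewrite !pq ?e // ltnW.
Qed.

Lemma clength_size p s t : s <= t -> t - s <= clength p s t <= 2 * (t - s).
Proof.
move=> st; rewrite -(subnKC st); move: (t - s)%N => {st}n.
elim: n => [|n IH]; first by rewrite addn0 clengthxx subnn.
rewrite addnS clengthS ?leq_addr //.
have := clen_bounds (p (s + n)%N) (p (s + n).+1); lia.
Qed.

Definition vshift p s := fun t => p (s + t)%N.
Definition vrev p l := fun t => p (l - t)%N.
Definition vcat p l q := fun t => if t <= l then p t else q (t - l)%N.

Lemma vcatl p l q t : t <= l -> vcat p l q t = p t.
Proof. by rewrite /vcat => ->. Qed.

Lemma vcatr p l q t : p l = q 0 -> l <= t -> vcat p l q t = q (t - l)%N.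
Proof.
move=> pq lt; rewrite /vcat; case: leqP => // tl.
have -> : t = l by lia.
by rewrite subnn.
Qed.

Lemma cpath_shift p l s : path p l -> s <= l -> path (vshift p s) (l - s).
Proof. by move=> pp sl t tl; rewrite /vshift addnS; apply: pp; lia. Qed.

Lemma cpath_take p l t : path p l -> t <= l -> path p t.
Proof. by move=> pp tl s st; apply: pp; lia. Qed.

Lemma cpath_rev p l : path p l -> path (vrev p l) l.
Proof.
move=> pp t tl; rewrite /vrev; apply: cadj_sym.
have -> : (l - t = (l - t.+1).+1)%N by lia.
by apply: pp; lia.
Qed.

Lemma cpath_cat p l q l' : p l = q 0 -> path p l -> path q l' -> path (vcat p l q) (l + l').
Proof.
move=> pq pp pq' t tl; case: (leqP t.+1 l) => tl'.
  by rewrite !vcatl; [apply: pp|lia|lia].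
rewrite !vcatr //; try lia.
have -> : (t.+1 - l = (t - l).+1)%N by lia.
by apply: pq'; lia.
Qed.

Lemma clength_shift p s t n : t <= n -> clength (vshift p s) t n = clength p (s + t) (s + n).
Proof. by move=> tr; apply: clength_eq => [|||i _]; rewrite ?/vshift ?addnA //; lia. Qed.

Lemma clength_rev p l s t : s <= t -> t <= l -> clength (vrev p l) s t = clength p (l - t) (l - s).
Proof.
move=> st; rewrite -(subnKC st); move: (t - s)%N => {st}n; elim: n => [|n IH] nl.
  by rewrite addn0 !clengthxx.
rewrite addnS clengthS ?leq_addr // IH; last by lia.
have e : (l - (s + n) = (l - (s + n).+1).+1)%N by lia.
rewrite /vrev clen_sym e -(@clengthD p (l - (s + n).+1) (l - (s + n).+1).+1 (l - s)); try lia.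
by rewrite clength1 addnC.
Qed.

Lemma clength_catl p l q s t : s <= t -> t <= l -> clength (vcat p l q) s t = clength p s t.
Proof. by move=> st tl; apply: clength_eq => // r rt; rewrite vcatl //; lia. Qed.

Lemma clength_catr p l q s t : p l = q 0 -> l <= s -> s <= t ->
  clength (vcat p l q) s t = clength q (s - l) (t - l).
Proof.
move=> pq ls st; apply: clength_eq; try lia; move=> r rt.
by rewrite vcatr //; [congr q; lia|lia].
Qed.

Lemma dle_path p l s t : path p l -> s <= t -> t <= l -> dle (clength p s t) (p s) (p t).
Proof.
move=> pp st tl; exists (vshift p s), (t - s)%N; split.
- by apply: cpath_shift => //; apply: cpath_take tl.
- by rewrite /vshift addn0.
- by rewrite /vshift subnKC.
- by rewrite clength_shift ?addn0 ?subnKC.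
Qed.

Lemma dle_refl u d : dle d u u.
Proof. by exists (fun=> u), 0; split => //; rewrite clengthxx. Qed.

Lemma dle_leq d d' u v : d <= d' -> dle d u v -> dle d' u v.
Proof. by move=> dd [p [l [? ? ? ?]]]; exists p, l; split=> //; lia. Qed.

Lemma dle_sym d u v : dle d u v -> dle d v u.
Proof.
move=> [p [l [pp pu pv pd]]]; exists (vrev p l), l; split.
- exact: cpath_rev.
- by rewrite /vrev subn0.
- by rewrite /vrev subnn.
- by rewrite clength_rev // subnn subn0.
Qed.

Lemma dle_trans d d' u v w : dle d u v -> dle d' v w -> dle (d + d') u w.
Proof.
move=> [p [l [pp pu pv pd]]] [q [l' [pq qv qw qd]]].
have e : p l = q 0 by rewrite pv.
exists (vcat p l q), (l + l')%N; split.
- exact: cpath_cat.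
- by rewrite vcatl.
- by rewrite vcatr ?leq_addr // addKn.
- rewrite -(@clengthD _ 0 l) ?leq_addr // clength_catl // clength_catr ?leq_addr //.
  by rewrite subnn addKn leq_add.
Qed.

Lemma dle_adj u v : adj u v -> dle 2 u v.
Proof.
move=> uv; exists (fun t => if t is 0 then u else v), 1%N; split=> //.
- by case.
- by rewrite clength1; case/andP: (clen_bounds u v).
Qed.

(** A shortcut between two intermediate vertices would give a shortcut between the ends, so
    minimality of the whole path passes to its subpaths. *)
Lemma geodP p l : path p l -> (forall d, dle d (p 0) (p l) -> clength p 0 l <= d) -> geod p l.
Proof.
move=> pp pmin; split=> // s t d /andP[st tl] std; rewrite mul1n.
have := pmin _ (dle_trans (dle_trans (dle_path pp (leq0n s) (leq_trans st tl)) std)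
   (dle_path pp tl (leqnn l))).
rewrite -(@clengthD p 0 s l) //; last by lia.
by rewrite -(@clengthD p s t l) //; lia.
Qed.

Lemma geod_min p l s t d : geod p l -> s <= t -> t <= l -> dle d (p s) (p t) -> clength p s t <= d.
Proof. by move=> [_ pm] st tl /pm; rewrite mul1n; apply; rewrite st. Qed.

(** Lengths are natural numbers, so a shortest path exists as soon as there is a path. *)
Lemma geod_exists d u v : dle d u v ->
  exists p l, [/\ geod p l, p 0 = u, p l = v & clength p 0 l <= d].
Proof.
move=> uv; have ex : exists d, `[< dle d u v >] by exists d; apply/asboolP.
case: (ex_minnP ex) => e /asboolP [p [l [pp pu pv pe]]] emin.
exists p, l; split=> //; last first.
  by apply: (leq_trans pe); apply: emin; apply/asboolP.
apply: geodP => // d' d'uv; apply: (leq_trans pe); apply: emin; apply/asboolP.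
by rewrite -pu -pv.
Qed.

Lemma geod_rev p l : geod p l -> geod (vrev p l) l.
Proof.
move=> [pp pm]; apply: geodP; first exact: cpath_rev.
move=> d; rewrite /vrev subn0 subnn clength_rev // subnn subn0 => /dle_sym /pm.
by rewrite mul1n; apply; rewrite leqnn.
Qed.

Lemma geod_sub p l s t : geod p l -> s <= t -> t <= l -> geod (vshift p s) (t - s).
Proof.
move=> gp st tl; apply: geodP.
  by apply: cpath_shift => //; apply: cpath_take tl; case: gp.
move=> d; rewrite clength_shift // /vshift addn0 subnKC // => /(geod_min gp).
exact.
Qed.

Lemma geod_take p l t : geod p l -> t <= l -> geod p t.
Proof. by move=> gp tl; have := geod_sub gp (leq0n t) tl; rewrite subn0. Qed.

(** Nearest-point projection to a path, obtained by minimising a natural number. *)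
Lemma near_vertex p l u d : (exists2 t, t <= l & dle d u (p t)) ->
  exists t e, [/\ t <= l, e <= d, dle e u (p t) &
    forall s e', s <= l -> dle e' u (p s) -> e <= e'].
Proof.
move=> [t tl utd].
pose P e := `[< exists2 t, t <= l & dle e u (p t) >].
have ex : exists e, P e by exists d; apply/asboolP; exists t.
case: (ex_minnP ex) => e /asboolP [t' t'l ut'] emin.
exists t', e; split=> //; first by apply: emin; apply/asboolP; exists t.
by move=> s e' sl us; apply: emin; apply/asboolP; exists s.
Qed.

End Paths.

(** * Translations, the word metric, cosets and concatenated quasi-geodesics *)

Section ConedOff.
Local Open Scope classical_set_scope.
Local Open Scope group_scope.
Variables (G : groupType) (S : seq G) (k : nat) (H : 'I_k -> set G).
Local Notation V := (cvertex G k).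
Local Notation adj := (cadj S H).
Local Notation dle := (cdist_le S H).
Local Notation path := (cpath S H).
Local Notation geod := (cgeodesic S H).
Local Notation wdle := (word_dist_le S).
Implicit Types (p q : nat -> V) (u v w : V) (l s t d c : nat) (x y g : G).

(** The isometric action of [G] on the coned-off graph by left multiplication. *)
Definition translate g u : V :=
  match u with Elt x => Elt k (g * x) | Cone i A => Cone i [set g * a | a in A] end.

Lemma translateK g : cancel (translate g) (translate g^-1).
Proof.
case=> [x|i A] /=; first by rewrite mulKg.
rewrite image_comp /comp; congr Cone; rewrite -[RHS]image_id.
by apply: eq_imagel => x _; rewrite mulKg.
Qed.

Lemma in_cone_translate g x i A : in_cone H x i A -> in_cone H (g * x) i [set g * a | a in A].
Proof.
rewrite /in_cone => ->; rewrite image_comp; apply: eq_imagel => h _ /=.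
by rewrite mulgA.
Qed.

Lemma cadj_translate g u v : adj u v -> adj (translate g u) (translate g v).
Proof.
case: u v => [x|i A] [y|j B] //=; try exact: in_cone_translate.
by rewrite invgM mulgA mulgVK.
Qed.

Lemma cpath_translate g p l : path p l -> path (translate g \o p) l.
Proof. by move=> pp t tl; apply: cadj_translate; apply: pp. Qed.

Lemma clength_translate g p s t : clength (translate g \o p) s t = clength p s t.
Proof.
by apply: eq_bigr => i _ /=; case: (p i) => [x|j A]; case: (p i.+1) => [y|j' B].
Qed.

Lemma dle_translate g d u v : dle d u v -> dle d (translate g u) (translate g v).
Proof.
move=> [p [l [pp pu pv pd]]]; exists (translate g \o p), l; split=> /=.
- exact: cpath_translate.
- by rewrite pu.
- by rewrite pv.
- by rewrite clength_translate.
Qed.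

Lemma geod_translate g p l : geod p l -> geod (translate g \o p) l.
Proof.
move=> [pp pm]; apply: geodP; first exact: cpath_translate.
move=> d /(dle_translate g^-1) /=; rewrite !translateK clength_translate => /pm.
by rewrite mul1n; apply; rewrite leqnn.
Qed.

Lemma wdle_leq c c' x y : c <= c' -> wdle c x y -> wdle c' x y.
Proof. by move=> cc [w [wc ws e]]; exists w; split=> //; apply: leq_trans cc. Qed.

Lemma wdle_refl c x : wdle c x x.
Proof. by exists [::]; rewrite big_nil mulVg. Qed.

Lemma wdle_trans c c' x y z : wdle c x y -> wdle c' y z -> wdle (c + c') x z.
Proof.
move=> [w [wc ws e]] [w' [wc' ws' e']]; exists (w ++ w'); split.
- by rewrite size_cat leq_add.
- by rewrite all_cat ws ws'.
- by rewrite big_cat /= -e -e' mulgA mulgK.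
Qed.

Lemma wdle_sym c x y : wdle c x y -> wdle c y x.
Proof.
move=> [w [wc ws e]]; exists (rev [seq a^-1 | a <- w]); split.
- by rewrite size_rev size_map.
- by rewrite all_rev all_map; apply: sub_all ws => a /letter_inv.
- have -> : y^-1 * x = (x^-1 * y)^-1 by rewrite invgM invgK.
  rewrite {}e; elim: w {wc ws} => [|a w IH]; first by rewrite !big_nil invg1.
  by rewrite big_cons invgM IH /= rev_cons -cats1 big_cat /= big_seq1.
Qed.

Lemma wdle_mulg g c x y : wdle c (g * x) (g * y) <-> wdle c x y.
Proof. by rewrite /word_dist_le invgM mulgA mulgVK. Qed.

Lemma wdleS c x z : wdle c.+1 x z -> exists y, wdle 1 x y /\ wdle c y z.
Proof.
move=> [[|a w] [wc /=]].
  by move=> _; rewrite big_nil => /mulg1_eq; rewrite invgK => <-; exists x; split; apply: wdle_refl.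
move=> /andP[aS ws]; rewrite big_cons => e; exists (x * a); split.
  by exists [:: a]; rewrite /= aS big_seq1 mulKg.
by exists w; split=> //; rewrite invgM -mulgA e mulKg.
Qed.

Lemma wdle0 x y : wdle 0 x y -> x = y.
Proof.
by move=> [[|a w] [// _ _]]; rewrite big_nil => /mulg1_eq; rewrite invgK.
Qed.

Lemma wdle1 x y : wdle 1 x y -> x = y \/ letter S (x^-1 * y).
Proof.
move=> [[|a [|b w]] [// _ /=]].
  by rewrite big_nil => _ /mulg1_eq; rewrite invgK; left.
by rewrite andbT big_seq1 => aS ->; right.
Qed.

Lemma wdle_dle c x y : wdle c x y -> dle (2 * c) (Elt k x) (Elt k y).
Proof.
elim: c x => [|c IH] x; first by move=> /wdle0 ->; apply: dle_refl.
move=> /wdleS [z [/wdle1 xz /IH zy]]; rewrite mulnS; apply: dle_trans zy.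
by case: xz => [->|xz]; [apply: dle_refl|apply: dle_adj].
Qed.

Lemma ball_finite c : exists B : seq G, forall x y, wdle c x y -> x^-1 * y \in B.
Proof.
elim: c => [|c [B IH]].
  by exists [:: 1] => x y /wdle0 ->; rewrite mulVg mem_head.
exists (B ++ [seq a * b | a <- S ++ [seq a^-1 | a <- S], b <- B]) => x y.
move=> /wdleS[z [/wdle1 [-> /IH|xz zy]]]; rewrite mem_cat; first by move->.
apply/orP; right; apply/allpairsP; exists (x^-1 * z, z^-1 * y); split=> /=.
- by rewrite mem_cat; case/orP: xz => [->//|/(map_f (fun a => a^-1))]; rewrite invgK orbC => ->.
- exact: IH.
- by rewrite mulgA mulgK.
Qed.

Hypothesis H_closed : forall i, group_closed [in H i].
Hypothesis S_gen : generated S = setT.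

Lemma wdle_total x y : exists c, wdle c x y.
Proof. by have : generated S (x^-1 * y) by rewrite S_gen. Qed.

Lemma dle_total x y : exists d, dle d (Elt k x) (Elt k y).
Proof. by have [c /wdle_dle] := wdle_total x y; exists (2 * c)%N. Qed.

Lemma in_cone_eq x i A : in_cone H x i A -> forall y, in_cone H y i A <-> H i (x^-1 * y).
Proof.
have [H1 HV] := H_closed i; have HM := group_closedM (H_closed i).
move=> -> y; split=> [e|xy].
  have : [set x * h | h in H i] y by rewrite e; exists 1; rewrite ?mulg1 //; apply: set_mem.
  by move=> [h hH <-]; rewrite mulKg.
rewrite /in_cone eqEsubset; split=> z [h hH <-].
  exists (y^-1 * x * h); last by rewrite !mulgA mulgV mul1g.
  apply: set_mem; apply: (HM (y^-1 * x)); last exact: mem_set.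
  by have := HV _ _ H1 (mem_set xy); rewrite mul1g invgM invgK.
exists (x^-1 * y * h); last by rewrite !mulgA mulgV mul1g.
by apply: set_mem; apply: (HM (x^-1 * y)); apply: mem_set.
Qed.

Lemma in_cone_dle x y i A : in_cone H x i A -> in_cone H y i A -> dle 2 (Elt k x) (Elt k y).
Proof.
move=> xA yA; exists (fun t => match t with 0 => Elt k x | 1 => Cone i A | _ => Elt k y end)%N, 2.
by split=> //; [case=> [|[]]|rewrite clengthS // clength1].
Qed.

Lemma penetrates_in_cone p l i A x y : path p l -> penetrates p l i A x y ->
  in_cone H x i A /\ in_cone H y i A.
Proof.
move=> pp [t [tl px pA py]]; split.
  by have := pp t (ltn_trans (ltnSn t) tl); rewrite px pA.
by have := pp t.+1 tl; rewrite pA py.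
Qed.

Lemma penetrates_rev p l i A x y : penetrates p l i A x y -> penetrates (vrev p l) l i A y x.
Proof.
move=> [t [tl px pA py]]; exists (l - t.+2)%N; rewrite /vrev; split; first by lia.
- by have -> : (l - (l - t.+2) = t.+2)%N by lia.
- by have -> : (l - (l - t.+2).+1 = t.+1)%N by lia.
- by have -> : (l - (l - t.+2).+2 = t)%N by lia.
Qed.

Lemma penetrates_translate g p l i A x y : penetrates p l i A x y ->
  penetrates (translate g \o p) l i [set g * a | a in A] (g * x) (g * y).
Proof.
by move=> [t [tl px pA py]]; exists t; split=> //=; rewrite ?px ?pA ?py.
Qed.

(** A repeated vertex would bound a subpath of positive length between points at distance 0. *)
Lemma qgeod_noback lam p l : quasi_geodesic S H lam p l -> without_backtracking p l.
Proof.
move=> [pp pm]; suff E s t : s <= t -> t <= l -> p s = p t -> s = t.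
  move=> s t i A sl tl ps pt.
  by case: (leqP s t) => st; [|symmetry]; apply: E; rewrite ?ps // ltnW.
move=> st tl e; have := pm s t 0; rewrite st tl muln0 => /(_ isT).
rewrite e => /(_ (dle_refl _ _ _ _)); have := clength_size p st; lia.
Qed.

(** Subpaths on one side of the junction are geodesic, so only those crossing it require the
    distance estimate. *)
Lemma qgeod_cat p l q l' : geod p l -> geod q l' -> p l = q 0 ->
  (forall s t d, s <= l -> t <= l' -> dle d (p s) (q t) ->
     (clength p s l + clength q 0 t <= 3 * d)%N) ->
  quasi_geodesic S H 3 (vcat p l q) (l + l').
Proof.
move=> [pp pm] [pq qm] e far; split; first exact: cpath_cat.
move=> s t d /andP[st tl]; case: (leqP t l) => tl'.
  rewrite !vcatl ?(leq_trans st) // clength_catl // => /pm.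
  by rewrite st tl' => /(_ isT); lia.
case: (leqP l s) => ls.
  rewrite !vcatr ?clength_catr // ?(ltnW tl') // => /qm.
  by move=> /(_ ltac:(lia)); lia.
rewrite vcatl ?(ltnW ls) // vcatr ?(ltnW tl') // => /far.
rewrite -(@clengthD _ _ _ s l t) ?(ltnW ls) ?(ltnW tl') //.
rewrite clength_catl ?(ltnW ls) // clength_catr ?(ltnW tl') // subnn.
by apply; lia.
Qed.

(* As [p l] is a point of [p] nearest to [q l'], it is at distance at most d from
   [q t] whenever [p s] and [q t] are at distance d; this gives 3 = 2 + 1. *)
Lemma qgeod_append p l q l' : geod p l -> geod q l' -> p l = q 0 ->
  (forall s d, s <= l -> dle d (q l') (p s) -> clength q 0 l' <= d) ->
  quasi_geodesic S H 3 (vcat p l q) (l + l').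
Proof.
move=> gp gq e near; apply: qgeod_cat => // s t d sl tl st.
have pq := proj1 gq; have tq := dle_path pq tl (leqnn _).
have := near s _ sl (dle_sym (dle_trans st tq)).
rewrite -(@clengthD _ _ _ 0 t l') // => h1.
have := dle_trans st (dle_sym (dle_path pq (leq0n t) tl)); rewrite -e => /(geod_min gp).
by move=> /(_ sl (leqnn _)); lia.
Qed.

(** Mirror image of [qgeod_append]: the first geodesic is now a shortest connection from its start
    to the second. *)
Lemma qgeod_prepend q l p l' : geod q l -> geod p l' -> q l = p 0 ->
  (forall s d, s <= l' -> dle d (q 0) (p s) -> clength q 0 l <= d) ->
  quasi_geodesic S H 3 (vcat q l p) (l + l').
Proof.
move=> gq gp e near; apply: qgeod_cat => // s t d sl tl st.
have pq := proj1 gq; have sq := dle_path pq (leq0n _) sl.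
have := near t _ tl (dle_trans sq st).
rewrite -(@clengthD _ _ _ 0 s l) // => h1.
have := dle_trans (dle_sym (dle_path pq sl (leqnn _))) st; rewrite e => /(geod_min gp).
by move=> /(_ (leq0n _) tl); lia.
Qed.

End ConedOff.

(** * Parabolic elements *)

Lemma pigeonhole (T T' : finType) (f : T -> T') : #|T'| < #|T| ->
  exists x, exists2 y, x != y & f x = f y.
Proof.
move=> lt; apply/injectivePn/injectiveP => /leq_card; by rewrite leqNgt lt.
Qed.

Definition infinite_order (G : groupType) (g : G) :=
  forall r, 0 < r -> (g ^+ r <> 1)%g.

Section Parabolic.
Local Open Scope classical_set_scope.
Local Open Scope group_scope.
Variables (G : groupType) (S : seq G) (k : nat) (H : 'I_k -> set G).
Local Notation V := (cvertex G k).
Local Notation dle := (cdist_le S H).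
Local Notation path := (cpath S H).
Local Notation geod := (cgeodesic S H).
Local Notation wdle := (word_dist_le S).
Implicit Types (p q : nat -> V) (u v w : V) (l s t d c : nat) (x y g b h : G).

(** A Cayley edge costs one letter and a passage through a cone at most [c], so [c.+1] letters per
    edge suffice. The induction strips the first edge, or the first two when they pass through a
    cone. *)
Lemma wdle_along c p l a b : path p l ->
  (forall i A x y, penetrates p l i A x y -> wdle c x y) ->
  p 0 = Elt k a -> p l = Elt k b -> wdle (l * c.+1) a b.
Proof.
elim/ltn_ind: l p a => l IH p a pp pen p0 pl.
case: l IH pp pen pl => [|l] IH pp pen pl.
  by move: pl; rewrite p0 => -[->]; apply: wdle_refl.
have step m y : m <= l -> p m.+1 = Elt k y -> wdle ((l.+1 - m.+1) * c.+1) y b.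
  move=> ml py; apply: (IH _ _ (vshift p m.+1)); rewrite /vshift ?addn0 ?subnKC //.
  - lia.
  - exact: cpath_shift.
  - move=> i A x z [t [tl px pA pz]]; apply: (pen i A); exists (m.+1 + t)%N.
    by rewrite -!addnS; split=> //; lia.
case p1: (p 1%N) => [y|i A].
  have := pp 0 isT; rewrite p0 p1 => ay.
  have := wdle_trans _ (step 0 y (leq0n _) p1); rewrite subSS subn0.
  move=> /(_ 1%N a) ab; apply: (@wdle_leq _ _ (1 + l * c.+1)%N); first by lia.
  by apply: ab; exists [:: a^-1 * y]; rewrite /= ay big_seq1.
(* A cone vertex cannot be the last one, since the path ends at a group element. *)
case: l pl pp pen step {IH} => [|l] pl pp pen step; first by rewrite p1 in pl.
have := pp 1%N isT; rewrite p1; case p2: (p 2) => [y|//] _.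
have := step 1%N y isT p2; rewrite !subSS subn0 => yb.
have ay : wdle c a y by apply: (pen i A); exists 0.
by apply: wdle_leq (wdle_trans ay yb); lia.
Qed.

(** The conclusion of bounded coset penetration as a directed relation between two paths, in a form
    that can be chained. *)
Definition companion c p l q l' := forall i A x y, penetrates p l i A x y ->
  wdle c x y \/ exists x' y', [/\ penetrates q l' i A x' y', wdle c x x' & wdle c y y'].

(** If the matching penetration of [q] is short, going round through its ends bounds that of [p] by
    [c + c' + c]. *)
Lemma companion_trans c c' p l q l' q2 l2 : companion c p l q l' -> companion c' q l' q2 l2 ->
  companion (2 * c + c') p l q2 l2.
Proof.
move=> pq qr i A x y /pq [xy|[x' [y' [/qr [xy|[x2 [y2 [pr xx yy]]]] xx' yy']]]].
- by left; apply: wdle_leq xy; lia.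
- left; apply: wdle_leq (wdle_trans xx' (wdle_trans xy (wdle_sym yy'))); lia.
- right; exists x2, y2; split=> //.
    by apply: wdle_leq (wdle_trans xx' xx); lia.
  by apply: wdle_leq (wdle_trans yy' yy); lia.
Qed.

Lemma penetrates_revE p l i A x y : penetrates (vrev p l) l i A x y -> penetrates p l i A y x.
Proof.
move=> /penetrates_rev [t [tl]]; rewrite /vrev => e1 e2 e3; exists t; split=> //.
- by move: e1; rewrite subKn //; lia.
- by move: e2; rewrite subKn //; lia.
- by move: e3; rewrite subKn //; lia.
Qed.

Lemma companion_rev c p l q l' : companion c (vrev p l) l (vrev q l') l' -> companion c p l q l'.
Proof.
move=> pq i A x y /penetrates_rev /pq [/wdle_sym|[y' [x' [/penetrates_revE]]]]; first by left.
by right; exists x', y'.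
Qed.

Hypothesis H_closed : forall i, group_closed [in H i].
Hypothesis S_gen : generated S = setT.
Hypothesis bcp : bounded_coset_penetration S H.

Lemma qgeod_companion lam : exists c, forall p q lp lq a b b',
  quasi_geodesic S H lam p lp -> quasi_geodesic S H lam q lq ->
  p 0 = Elt k a -> q 0 = Elt k a -> p lp = Elt k b -> q lq = Elt k b' -> wdle 1 b b' ->
  companion c p lp q lq.
Proof.
have [c bc] := bcp lam; exists c => p q lp lq a b b' gp gq p0 q0 pl ql bb i A x y pen.
have [none some] := bc p q lp lq a b b' gp (qgeod_noback gp) gq (qgeod_noback gq)
  p0 q0 pl ql bb i A x y pen.
case: (EM (exists x' y', penetrates q lq i A x' y')) => [[x' [y' pen']]|no].
  by right; exists x', y'; have [] := some _ _ pen'.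
by left; apply: none => x' y' pen'; apply: no; exists x', y'.
Qed.

(** Bounded coset penetration allows endpoints one letter apart. A path of [K] letters from [b] to
    [b'] is followed, with an auxiliary geodesic from [a] to each intermediate point. *)
Lemma geod_companion_start K : exists c, forall p q lp lq a b b',
  geod p lp -> geod q lq ->
  p 0 = Elt k a -> q 0 = Elt k a -> p lp = Elt k b -> q lq = Elt k b' -> wdle K b b' ->
  companion c p lp q lq.
Proof.
have [c1 h1] := qgeod_companion 1; elim: K => [|K [c hc]].
  exists c1 => p q lp lq a b b' gp gq p0 q0 pl ql bb.
  by apply: (h1 p q lp lq a b b') => //; apply: wdle_leq bb.
exists (2 * c1 + c)%N => p q lp lq a b b' gp gq p0 q0 pl ql /wdleS [b'' [bb bb']].
have [d /geod_exists [r [lr [gr r0 rl _]]]] := dle_total H S_gen a b''.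
have pr := h1 p r lp lr a b b'' gp gr p0 r0 pl rl bb.
have rq := hc r q lr lq a b'' b' gr gq r0 q0 rl ql bb'.
exact: companion_trans pr rq.
Qed.

(** The geodesic from [a] to [b'] cuts the quadrilateral into two triangles with a common vertex
    each; the second is treated after reversing its sides. *)
Lemma geod_companion K : exists c, forall p q lp lq a a' b b',
  geod p lp -> geod q lq ->
  p 0 = Elt k a -> q 0 = Elt k a' -> p lp = Elt k b -> q lq = Elt k b' ->
  wdle K a a' -> wdle K b b' -> companion c p lp q lq.
Proof.
have [c hc] := geod_companion_start K; exists (2 * c + c)%N.
move=> p q lp lq a a' b b' gp gq p0 q0 pl ql aa bb.
have [d /geod_exists [r [lr [gr r0 rl _]]]] := dle_total H S_gen a b'.
have pr := hc p r lp lr a b b' gp gr p0 r0 pl rl bb.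
apply: companion_trans pr _; apply: companion_rev.
apply: (hc _ _ _ _ b' a a' (geod_rev gr) (geod_rev gq)); rewrite /vrev ?subn0 ?subnn //.
Qed.

(** The powers of [g] are distinct, while a ball of the word metric is finite. *)
Lemma infinite_order_far g : infinite_order g -> forall c, exists n, ~ wdle c 1 (g ^+ n).
Proof.
move=> g_inf c; have [B hB] := ball_finite S c; apply: contrapT => /forallNP near.
have gB n : g ^+ n \in B by have := hB _ _ (contrapT (near n)); rewrite invg1 mul1g.
have : uniq [seq g ^+ n | n <- iota 0 (size B).+1].
  rewrite map_inj_uniq ?iota_uniq // => m n.
  wlog mn : m n / m <= n => [hw|e].
    by case: (leqP m n) => [/hw//|/ltnW /hw h /esym/h].
  apply/eqP; rewrite eqn_leq mn -subn_eq0 -leqn0 leqNgt; apply/negP => /g_inf.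
  by apply; rewrite expgnFr // e mulgV.
move=> /uniq_leq_size h; have /h : {subset [seq g ^+ n | n <- iota 0 (size B).+1] <= B}.
  by move=> _ /mapP[n _ ->].
by rewrite size_map size_iota ltnn.
Qed.

Lemma elt_dist d x y : dle d (Elt k x) (Elt k y) -> x <> y -> 1 < d.
Proof.
move=> [p [[|[|l]] [pp p0 pl pd]]] ne.
- by case: ne; move: pl; rewrite p0 => -[].
- by move: pd; rewrite clength1 p0 pl.
- by have := clength_size p (leq0n l.+2); lia.
Qed.

(** For large [n] the path from [h] to [g ^+ n * h] through the cone of the coset of [h] is a long
    penetration. Its translate by [b] has nearby ends because [b] commutes with [g ^+ n], so it
    penetrates the same coset; its only cone is that of the coset of [b * h]. *)
Lemma commute_parabolic g b i h : infinite_order g -> H i (h^-1 * g * h) ->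
  commute b g -> H i (h^-1 * b * h).
Proof.
move=> g_inf gH bg; have [K hK] := wdle_total S_gen h (b * h).
have [M hM] := wdle_total S_gen 1 h.
have [c hc] := geod_companion K; have [n hn] := infinite_order_far g_inf (M + c + M).
have [H1 _] := H_closed i; have HM := group_closedM (H_closed i).
pose A := [set h * a | a in H i].
have hA : in_cone H h i A by [].
have gA : in_cone H (g ^+ n * h) i A.
  apply/(in_cone_eq H_closed hA); elim: n {hn} => [|n IH].
    by rewrite expg0 mul1g mulVg; apply: set_mem.
  have -> : h^-1 * (g ^+ n.+1 * h) = (h^-1 * g * h) * (h^-1 * (g ^+ n * h)).
    by rewrite expgS !mulgA mulgK.
  by apply: set_mem; apply: HM; apply: mem_set.
have far : ~ wdle c h (g ^+ n * h).
  move=> near; apply: hn; apply: wdle_trans (wdle_trans hM near) _.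
  by rewrite -{2}(mulg1 (g ^+ n)) wdle_mulg; apply: wdle_sym.
pose p t := match t with 0 => Elt k h | 1%N => Cone i A | _ => Elt k (g ^+ n * h) end.
have gp : geod p 2.
  apply: geodP; first by case=> [|[]].
  move=> d /elt_dist hd; rewrite clengthS // clength1; apply: hd => e.
  by apply: far; rewrite -e; apply: wdle_refl.
have bgn : commute b (g ^+ n) by apply: commuteX.
have := hc p (translate b \o p) 2 2 h (b * h) (g ^+ n * h) (b * (g ^+ n * h)) gp
  (geod_translate _ gp) erefl erefl erefl erefl hK.
rewrite mulgA bgn -mulgA wdle_mulg => /(_ hK i A h (g ^+ n * h)) [].
- by exists 0.
- by [].
(* The path has two edges, so a penetration can only start at index 0. *)
move=> [x' [y' [[[|t] [tl _ pA _]] _ _]]]; last by lia.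
case: pA => bA; have := in_cone_translate b hA; rewrite bA => /(in_cone_eq H_closed hA).
by rewrite mulgA.
Qed.

(** A geodesic from 1 to a far power of [g] has at most [D] edges, hence one long penetration, of a
    coset [A] say. Its translates by [g ^+ j], [j <= D.+1], have nearby ends, so it penetrates all
    the cosets [g ^+ j * A]. Two of these coincide, and a positive power of [g] stabilises a
    coset. *)
Lemma bounded_orbit_parabolic g D : infinite_order g ->
  (forall n, dle D (Elt k 1) (Elt k (g ^+ n))) ->
  exists i h r, 0 < r /\ H i (h^-1 * g ^+ r * h).
Proof.
move=> g_inf bnd; have [K1 hK1] := wdle_total S_gen 1 g.
have hK j : j <= D.+1 -> wdle (D.+1 * K1) 1 (g ^+ j).
  move=> jD; apply: (@wdle_leq _ _ (j * K1)); first by rewrite leq_mul2r jD orbT.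
  elim: j {jD} => [|j IH]; first exact: wdle_refl.
  rewrite mulSn expgS; apply: wdle_trans hK1 _.
  by rewrite -{1}(mulg1 g) wdle_mulg.
have [c hc] := geod_companion (D.+1 * K1).
have [n hn] := infinite_order_far g_inf (D * c.+1).
have [p [l [gp p0 pl pD]]] := geod_exists (bnd n).
have lD : l <= D by have := clength_size p (leq0n l); lia.
have [i [A [x [y [pen far]]]]] : exists i A x y, penetrates p l i A x y /\ ~ wdle c x y.
  apply: contrapT => no; apply: hn; apply: (@wdle_leq _ _ (l * c.+1)).
    by rewrite leq_mul2r lD orbT.
  apply: (wdle_along (proj1 gp)) p0 pl => i A x y pen; apply: contrapT => far.
  by apply: no; exists i, A, x, y.
have [xA _] := penetrates_in_cone (proj1 gp) pen.
have idx (j : 'I_D.+2) : exists t : 'I_D.+1, p t.+1 = Cone i [set g ^+ j * a | a in A].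
  have jD : j <= D.+1 by rewrite -ltnS.
  have [] := hc (translate (g ^+ j) \o p) p l l (g ^+ j) 1 (g ^+ j * g ^+ n) (g ^+ n)
    (geod_translate _ gp) gp _ p0 _ pl (wdle_sym (hK _ jD)) _ i _ _ _
    (penetrates_translate (g ^+ j) pen).
  - by rewrite /= p0 /= mulg1.
  - by rewrite /= pl.
  - rewrite -expgnDr addnC expgnDr -{2}(mulg1 (g ^+ n)) wdle_mulg.
    exact: wdle_sym (hK _ jD).
  - by rewrite wdle_mulg.
  move=> [x' [y' [[t [tl _ pA _]] _ _]]].
  by exists (@Ordinal D.+1 t ltac:(lia)).
have [f hf] := choice idx.
(* There are [D + 2] exponents but at most [D + 1] positions on the geodesic. *)
have [|j [j' ne fe]] := @pigeonhole _ _ f; first by rewrite !card_ord.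
wlog jj : j j' ne fe / j < j' => [hw|].
  case: (ltngtP j j') => [|/hw|/val_inj e]; first exact: hw.
    by apply; rewrite 1?eq_sym.
  by rewrite e eqxx in ne.
exists i, x, (j' - j)%N; split; first by rewrite subn_gt0.
have := hf j'; rewrite -fe hf => -[e].
have := in_cone_translate (g ^+ j') xA; rewrite -e.
move=> /(in_cone_eq H_closed (in_cone_translate (g ^+ j) xA)).
rewrite invgM -{1}(subnKC (ltnW jj)) expgnDr !mulgA.
by rewrite mulgVK.
Qed.

Definition thin delta := forall (p q r : nat -> V) (lp lq lr : nat),
  geod p lp -> geod q lq -> geod r lr ->
  p lp = q 0 -> q lq = r 0 -> r lr = p 0 ->
  forall t, t <= lp -> near_path S H delta (p t) q lq \/ near_path S H delta (p t) r lr.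

(** A diagonal cuts the quadrilateral into two thin triangles. A point near one of the short sides
    is near the corresponding end of [q], which gives the last two outcomes. *)
Lemma thin_quadrilateral delta p q lp lq e e' t : thin delta -> geod p lp -> geod q lq ->
  dle e (q 0) (p 0) -> dle e' (q lq) (p lp) -> t <= lq ->
  [\/ exists2 s, s <= lp & dle (2 * delta) (q t) (p s),
      dle (2 * delta + e) (q t) (q 0) | dle (2 * delta + e') (q t) (q lq)].
Proof.
move=> th gp gq d0 dl tl.
have dq := dle_path (proj1 gq) (leq0n lq) (leqnn lq).
have [r [lr [gr r0 rl _]]] := geod_exists (dle_trans (dle_sym dq) d0).
have [a [la [ga a0 al ae]]] := geod_exists (dle_sym d0).
have [b [lb [gb b0 bl be]]] := geod_exists (dle_sym dl).
have := th q r a lq lr la gq gr ga; rewrite r0 rl a0 al => /(_ erefl erefl erefl t tl).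
move=> [[s sl ds]|[s sl ds]]; last first.
  have := dle_trans ds (dle_path (proj1 ga) sl (leqnn _)); rewrite al => d.
  apply: Or32; apply: dle_leq d; move: ae.
  by rewrite -(@clengthD _ _ _ 0 s la) //; lia.
have := th r p b lr lp lb gr gp gb; rewrite r0 rl b0 bl => /(_ erefl erefl erefl s sl).
move=> [[s' sl' ds']|[s' sl' ds']].
  by apply: Or31; exists s' => //; rewrite mul2n -addnn; apply: dle_trans ds ds'.
have := dle_trans (dle_trans ds ds') (dle_path (proj1 gb) sl' (leqnn _)); rewrite bl => d.
apply: Or33; apply: dle_leq d; move: be.
by rewrite -(@clengthD _ _ _ 0 s' lb) //; lia.
Qed.

End Parabolic.

(** * Acylindricity *)

Lemma pigeonhole_fiber (T T' : finType) F (f : T -> T') : F * #|T'| < #|T| ->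
  exists y, F < #|[pred x | f x == y]|.
Proof.
move=> lt; apply/existsP; rewrite -[[exists _, _]]negbK negb_exists; apply/negP => /forallP le.
move: lt; rewrite ltnNge => /negP; apply.
rewrite -sum1_card (partition_big f predT) //= mulnC -sum_nat_const.
apply: leq_sum => y _; by rewrite sum1_card leqNgt; apply: le.
Qed.

Section Acylindrical.
Local Open Scope classical_set_scope.
Local Open Scope group_scope.
Variables (G : groupType) (S : seq G) (k : nat) (H : 'I_k -> set G).
Local Notation V := (cvertex G k).
Local Notation dle := (cdist_le S H).
Local Notation path := (cpath S H).
Local Notation geod := (cgeodesic S H).
Local Notation wdle := (word_dist_le S).
Implicit Types (p q : nat -> V) (u v w : V) (l s t d c : nat) (x y g b h : G).

Lemma clength_le p s t l : s <= t -> t <= l -> clength p s t <= clength p s l.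
Proof. by move=> st tl; rewrite -(@clengthD _ _ p s t l) // leq_addr. Qed.

Lemma clength_ge p s t l : s <= t -> t <= l -> clength p t l <= clength p s l.
Proof. by move=> st tl; rewrite -(@clengthD _ _ p s t l) // leq_addl. Qed.

(** The first vertex of depth at least [X] overshoots by less than one edge. If it is a cone vertex,
    the next vertex is a group element one unit further. *)
Lemma elt_at_depth p l X a b : path p l -> p 0 = Elt k a -> p l = Elt k b ->
  X <= clength p 0 l ->
  exists t y, [/\ t <= l, p t = Elt k y & X <= clength p 0 t <= X.+2].
Proof.
move=> pp p0 pl Xl.
have ex : exists t, (t <= l) && (X <= clength p 0 t) by exists l; rewrite leqnn.
case: (ex_minnP ex) => -[|t] /andP[tl Xt] tmin.
  by exists 0, a; split=> //; move: Xt; rewrite clengthxx; lia.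
have lt : clength p 0 t < X.
  by rewrite ltnNge; apply/negP => Xt'; have := tmin t; rewrite Xt' (ltnW tl) ltnn => /(_ isT).
have le := clen_bounds (p t) (p t.+1); rewrite clengthS // in Xt.
case pt: (p t.+1) => [y|i A].
  by exists t.+1, y; split=> //; rewrite clengthS //; lia.
have tl' : t.+1 < l by rewrite ltn_neqAle tl andbT; apply/eqP => e; rewrite e pl in pt.
have := pp _ tl'; rewrite pt; case pt': (p t.+2) => [y|//] _.
by exists t.+2, y; split=> //; rewrite !clengthS // pt pt' /=; rewrite pt in Xt le; lia.
Qed.

Hypothesis S_gen : generated S = setT.
Hypothesis bcp : bounded_coset_penetration S H.
Variable delta : nat.
Hypothesis H_thin : thin S H delta.
Local Notation D := (2 * delta)%N.

Section Bigon.
Variables (c eps : nat) (p q : nat -> V) (lp lq : nat) (a b a' b' : G).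
Hypothesis companion3 : forall p q lp lq a b b',
  quasi_geodesic S H 3 p lp -> quasi_geodesic S H 3 q lq ->
  p 0 = Elt k a -> q 0 = Elt k a -> p lp = Elt k b -> q lq = Elt k b' -> wdle 1 b b' ->
  companion S c p lp q lq.
Hypotheses (gp : geod p lp) (gq : geod q lq).
Hypotheses (p0 : p 0 = Elt k a) (pl : p lp = Elt k b).
Hypotheses (q0 : q 0 = Elt k a') (ql : q lq = Elt k b').
Hypotheses (aa' : dle eps (Elt k a) (Elt k a')) (bb' : dle eps (Elt k b) (Elt k b')).

Variables (alpha : nat -> V) (la s1 : nat).
Hypotheses (galpha : geod alpha la) (alpha0 : alpha 0 = Elt k a) (alphal : alpha la = q s1).
Hypothesis alpha_min :
  forall s d, s <= lq -> dle d (Elt k a) (q s) -> clength alpha 0 la <= d.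

(* The first path follows p to a vertex nearest to y and then a geodesic r to y;
   the second one follows the shortest connection alpha from a to q and then q.
   Both are (3, 0)-quasi-geodesics from a to y. *)
Lemma bigon t1 y : s1 <= t1 -> t1 <= lq -> q t1 = Elt k y ->
  D + eps < clength q 0 t1 -> D + eps < clength q t1 lq ->
  exists t r lr, [/\ t <= lp, geod r lr, p t = r 0, r lr = Elt k y & clength r 0 lr <= D] /\
   (companion S c (vcat p t r) (t + lr) (vcat alpha la (vshift q s1)) (la + (t1 - s1)) /\
    companion S c (vcat alpha la (vshift q s1)) (la + (t1 - s1)) (vcat p t r) (t + lr)).
Proof.
move=> st tl qy far0 farl.
have qp0 : dle eps (q 0) (p 0) by rewrite q0 p0; apply: dle_sym.
have qpl : dle eps (q lq) (p lp) by rewrite ql pl; apply: dle_sym.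
(* The two ends of [q] are too far from [y] for the other outcomes of the quadrilateral. *)
have near : exists2 s, s <= lp & dle D (q t1) (p s).
  have [//|d|d] := thin_quadrilateral H_thin gp gq qp0 qpl tl.
    by have := geod_min gq (leq0n _) tl (dle_sym d); lia.
  by have := geod_min gq tl (leqnn _) d; lia.
have [t [e [tlp eD de emin]]] := near_vertex near.
have [r [lr [gr r0 rl re]]] := geod_exists (dle_sym de).
exists t, r, lr; split; first by split=> //; [rewrite rl|lia].
have e1 : p t = r 0 by [].
have e2 : alpha la = vshift q s1 0 by rewrite /vshift addn0.
have g1 : quasi_geodesic S H 3 (vcat p t r) (t + lr).
  apply: qgeod_append => // [|s d sl]; first exact: geod_take gp tlp.
  by rewrite rl => /(emin s d (leq_trans sl tlp)); lia.
have g2 : quasi_geodesic S H 3 (vcat alpha la (vshift q s1)) (la + (t1 - s1)).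
  apply: qgeod_prepend => // [|s d sl]; first exact: geod_sub gq st tl.
  by rewrite alpha0; apply: alpha_min; lia.
have s10 : vcat p t r 0 = Elt k a by rewrite vcatl.
have s20 : vcat alpha la (vshift q s1) 0 = Elt k a by rewrite vcatl.
have s1l : vcat p t r (t + lr) = Elt k y by rewrite vcatr ?leq_addr // addKn rl.
have s2l : vcat alpha la (vshift q s1) (la + (t1 - s1)) = Elt k y.
  by rewrite vcatr ?leq_addr // addKn /vshift subnKC.
split; apply: (@companion3 _ _ _ _ a y y) => //; exact: wdle_refl.
Qed.

End Bigon.

(* Take points u1, u2 of q far from its ends and far from each other.  If q makes
   a long penetration before u1, the bigon at u2 makes p penetrate the same
   coset, since r stays close to u2.  Otherwise the bigon at u1 bounds all
   penetrations of r, and the word distance of u1 to p. *)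
Lemma close_pair eps : exists N C, forall p q lp lq a b a' b',
  geod p lp -> geod q lq -> p 0 = Elt k a -> p lp = Elt k b ->
  q 0 = Elt k a' -> q lq = Elt k b' ->
  dle eps (Elt k a) (Elt k a') -> dle eps (Elt k b) (Elt k b') ->
  N <= clength q 0 lq ->
  exists s t (v v' : G), [/\ s <= lp, t <= lq, p s = Elt k v, q t = Elt k v' & wdle C v v'].
Proof.
have [c hc] := qgeod_companion bcp 3.
(* [X1] exceeds [eps + eps + 2 + (D + 1)], the bound for the depth of [u1] in the last
   contradiction; the gap from [u1] to [u2] exceeds [D + 2]. *)
pose X1 := (2 * eps + D + 4)%N; pose X2 := (X1 + D + 5)%N.
(* [N] leaves more than [D + eps] after [u2]. [C] covers a penetration match ([c]) as well as a walk
   of at most [D + 1] edges whose penetrations are bounded by [3 * c]. *)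
exists (X2 + 2 + D + eps + 1)%N, (c + D.+1 * (3 * c).+1)%N.
move=> p q lp lq a b a' b' gp gq p0 pl q0 ql aa bb big.
(* [s1] is the foot on [q] of a shortest connection from [a]; its depth is at most [2 * eps]. *)
have [s1 [e [s1l eeps de emin]]] : exists s e, [/\ s <= lq, e <= eps, dle e (Elt k a) (q s) &
    forall s' e', s' <= lq -> dle e' (Elt k a) (q s') -> e <= e'].
  by apply: near_vertex; exists 0; rewrite ?q0.
have [al [la [gal al0 all ale]]] := geod_exists de.
have al_min s d : s <= lq -> dle d (Elt k a) (q s) -> clength al 0 la <= d.
  by move=> sl /(emin _ _ sl); lia.
have s1X : clength q 0 s1 <= 2 * eps.
  have := dle_trans (dle_sym aa) de; rewrite -q0 => /(geod_min gq (leq0n _) s1l); lia.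
have X1l : X1 <= clength q 0 lq by rewrite /X2 in big; lia.
have [t1 [u1 [t1l qu1 /andP[t1X t1X']]]] := elt_at_depth (proj1 gq) q0 ql X1l.
have X2l : X2 <= clength q 0 lq by lia.
have [t2 [u2 [t2l qu2 /andP[t2X t2X']]]] := elt_at_depth (proj1 gq) q0 ql X2l.
have e1 := clengthD q (leq0n t1) t1l; have e2 := clengthD q (leq0n t2) t2l.
have s1t1 : s1 <= t1.
  by rewrite leqNgt; apply/negP => lt; have := clength_le q (leq0n t1) (ltnW lt); lia.
have t1t2 : t1 <= t2.
  by rewrite leqNgt; apply/negP => lt; have := clength_le q (leq0n t2) (ltnW lt); lia.
have b1 := bigon hc gp gq p0 pl q0 ql aa bb gal al0 all al_min s1t1 t1l qu1.
have b2 := bigon hc gp gq p0 pl q0 ql aa bb gal al0 all al_min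
  (leq_trans s1t1 t1t2) t2l qu2.
have all0 : al la = vshift q s1 0 by rewrite /vshift addn0.
case: (EM (exists r i A x y, [/\ s1 <= r, r.+2 <= t1, q r = Elt k x & q r.+1 = Cone i A] /\
   q r.+2 = Elt k y /\ ~ wdle c x y)).
  move=> [r [i [A [x [y [[sr rt qx qA] [qy far]]]]]]].
  have [||t [ga [lga [[tl gga ga0 gal' gaD] [_ cmp]]]]] := b2; try lia.
  have pen : penetrates (vcat al la (vshift q s1)) (la + (t2 - s1)) i A x y.
    exists (la + (r - s1))%N; split; first by lia.
    - by rewrite vcatr ?leq_addr // addKn /vshift subnKC.
    - by rewrite -addnS vcatr ?leq_addr // addKn /vshift addnS subnKC.
    - by rewrite -!addnS vcatr ?leq_addr // addKn /vshift !addnS subnKC.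
  have [//|[x' [y' [[j [jl jx jA jy]] xx' yy']]]] := cmp _ _ _ _ pen.
  case: (leqP j t) => jt.
    exists j, r, x', x; split=> //; try lia; first by rewrite -jx vcatl.
    by apply: wdle_leq (wdle_sym xx'); lia.
  (* Here the match lies on the connection to [u2], so [x'] is within [D] of [u2] and [x] within
     [D + 2], although [x] comes before [u1]. *)
  exfalso; have xA : in_cone H x i A.
    by have := proj1 gq r; rewrite qx qA; apply; lia.
  have pv := cpath_cat ga0 (cpath_take (proj1 gp) tl) (proj1 gga).
  have x'A : in_cone H x' i A by have := pv j; rewrite jx jA; apply; lia.
  have := in_cone_dle S xA x'A.
  have x'u : dle D (Elt k x') (Elt k u2).
    have jl' : j <= t + lga by lia.
    have := dle_path pv jl' (leqnn _); rewrite jx vcatr ?leq_addr // addKn gal'.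
    apply: dle_leq; rewrite clength_catr //; last exact: ltnW.
    by rewrite addKn; apply: leq_trans (clength_ge _ (leq0n _) _) gaD; lia.
  move=> /(fun f => dle_trans f x'u); rewrite -qx -qu2 => d.
  have rt2 : r <= t2 by lia.
  have := geod_min gq rt2 t2l d; have rt1 : r <= t1 by lia.
  have := clength_ge q rt1 t1t2; have := clengthD q (leq0n t1) t1t2; lia.
move=> no; have [||t [ga [lga [[tl gga ga0 gal' gaD] [cmp _]]]]] := b1; try lia.
have pv := cpath_cat ga0 (cpath_take (proj1 gp) tl) (proj1 gga).
(* If [p t] is a cone vertex, one step back along [p] leads to a group element. *)
have [t0 [v [t0t pv0 t01 t0c]]] : exists t0 (v : G),
    [/\ t0 <= t, p t0 = Elt k v, t <= t0.+1 & clength p t0 t <= 1].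
  case pt: (p t) => [v|i A]; first by exists t, v; rewrite clengthxx; split=> //; lia.
  case: t tl pt {ga0 cmp pv} => [|t] tl pt; first by rewrite p0 in pt.
  have := proj1 gp _ tl; rewrite pt; case pt0: (p t) => [v|//] _.
  by exists t, v; rewrite clength1 pt pt0.
exists t0, t1, v, u1; split=> //; first by lia.
have t0l : t0 <= t + lga by lia.
apply: (@wdle_leq _ _ ((t + lga - t0) * (3 * c).+1)).
  apply: leq_trans (leq_addl _ _); rewrite leq_mul2r; apply/orP; right.
  by have := clength_size ga (leq0n lga); lia.
apply: (wdle_along (cpath_shift pv t0l)); last first.
- by rewrite /vshift subnKC // vcatr ?leq_addr // addKn.
- by rewrite /vshift addn0 vcatl.
move=> i A x y [r [rl rx rA ry]].
have pen : penetrates (vcat p t ga) (t + lga) i A x y.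
  by exists (t0 + r)%N; rewrite -!addnS; split=> //; lia.
have [xy|[x' [y' [[j [jl jx jA jy]] xx' yy']]]] := cmp _ _ _ _ pen.
  by apply: wdle_leq xy; lia.
(* The match lies on [q], where penetrations are short by assumption, or on the connection [al]. *)
case: (leqP la j) => jla.
  have x'y' : wdle c x' y'.
    apply: contrapT => far; apply: no.
    exists (s1 + (j - la))%N, i, A, x', y'; split; last split=> //.
    - rewrite !vcatr // in jx jA; try lia; split; [lia|lia|by []|].
      by rewrite -addnS -subSn.
    - rewrite vcatr // in jy; last by lia.
      by rewrite -!addnS -!subSn // ltnW.
  by apply: wdle_leq (wdle_trans (wdle_trans xx' x'y') (wdle_sym yy')); lia.
(* A match on [al] is within [eps] of [a]. Since [x] is near both [u1] and this match, the depth of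
   [u1] would be less than [X1]. *)
exfalso; have pv2 : path (vcat al la (vshift q s1)) (la + (t1 - s1)).
  apply: cpath_cat => //; first exact: (proj1 gal).
  exact: (proj1 (geod_sub gq s1t1 t1l)).
have [xA _] := penetrates_in_cone pv pen.
have x'A : in_cone H x' i A by have := pv2 j; rewrite jx jA; apply; lia.
have x'x := in_cone_dle S x'A xA.
have ax' : dle eps (Elt k a) (Elt k x').
  have := dle_path (proj1 gal) (leq0n j) (ltnW jla).
  rewrite al0 -jx vcatl ?(ltnW jla) //; apply: dle_leq.
  by apply: leq_trans (clength_le _ (leq0n _) (ltnW jla)) _; lia.
have xu : dle D.+1 (Elt k x) (Elt k u1).
  have rl' : t0 + r <= t + lga by lia.
  have := dle_path pv rl' (leqnn _); rewrite -/(vshift _ _ _) rx vcatr ?leq_addr // addKn gal'.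
  apply: dle_leq; apply: leq_trans (clength_ge _ (leq_addr _ _) rl') _.
  rewrite -(@clengthD _ _ _ t0 t) ?leq_addr // clength_catl // clength_catr ?leq_addr //.
  by rewrite subnn addKn; lia.
have := dle_trans (dle_sym aa) (dle_trans ax' (dle_trans x'x xu)).
by rewrite -q0 -qu1 => /(geod_min gq (leq0n _) t1l); lia.
Qed.

(** By [close_pair], each [w] in [W] carries some group element [z] of the geodesic to within [C] of
    another such element [v]. Hence [w = v * h * z^-1] with [h] in a finite ball, and the number of
    triples is bounded. *)
Lemma acylindrical eps : exists N0, forall N, N0 <= N -> exists F, forall p l a b (W : seq G),
  geod p l -> p 0 = Elt k a -> p l = Elt k b -> N <= clength p 0 l <= N.+2 ->
  uniq W -> {in W, forall w : G, dle eps (Elt k a) (Elt k (w * a)) /\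
                             dle eps (Elt k b) (Elt k (w * b))} ->
  size W <= F.
Proof.
have [N0 [C hC]] := close_pair eps; have [B hB] := ball_finite S C.
exists N0 => N N0N; exists (N.+3 * size B * N.+3)%N => p l a b W gp p0 pl /andP[Nl lN] uW hW.
have [L sL inL] : exists2 L : seq G, size L <= N.+3 &
    forall n x, n <= l -> p n = Elt k x -> x \in L.
  (* Cone vertices are sent to 1, which only enlarges the list. *)
  pose elt (v : V) := if v is Elt x then x else 1.
  exists [seq elt (p s) | s <- iota 0 l.+1].
    by rewrite size_map size_iota; have := clength_size p (leq0n l); lia.
  by move=> n x nl pn; apply/mapP; exists n; rewrite ?mem_iota ?pn //; lia.
pose LBL := [seq h * y^-1 | h <- [seq x * z | x <- L, z <- B], y <- L].
have sub : {subset W <= LBL}.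
  move=> w /hW [wa wb].
  have [] := hC p (translate w \o p) l l a b (w * a) (w * b) gp (geod_translate w gp) p0 pl.
  - by rewrite /= p0.
  - by rewrite /= pl.
  - by [].
  - by [].
  - by rewrite clength_translate; lia.
  move=> s [t [v [v' [sl tl pv]]]] /=; case pt: (p t) => [z|//] [<-] /hB vB.
  apply/allpairsP; exists (w * z, z); split=> /=; [|exact: inL pt|by rewrite mulgK].
  apply/allpairsP; exists (v, v^-1 * (w * z)); split=> //=; first exact: inL pv.
  by rewrite mulVKg.
apply: leq_trans (uniq_leq_size uW sub) _.
by rewrite !size_allpairs !leq_mul.
Qed.

(** Products of powers of [x] and [y] almost preserve a long geodesic from 1 to [g ^+ n]. Sorting
    them by their shift along it yields many quotients that almost fix two distant points, against
    acylindricity. *)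
Lemma unbounded_orbit_centraliser g x y :
  (forall d, exists n, ~ dle d (Elt k 1) (Elt k (g ^+ n))) ->
  commute x g -> commute y g ->
  exists i j i' j', (i, j) <> (i', j') /\ x ^+ i * y ^+ j = x ^+ i' * y ^+ j'.
Proof.
(* A quotient will move [m] by at most [2 * D] and [b] by at most [D + 3 * D]. Taking [N] above
   [3 * D] keeps [b] away from the corner at [m]. *)
move=> unb xg yg; pose eps := (4 * D)%N.
have [N0 hN0] := acylindrical eps; pose N := (N0 + 3 * D + 1)%N.
have [F hF] := hN0 N ltac:(lia).
have [kx hx] := dle_total H S_gen 1 x; have [ky hy] := dle_total H S_gen 1 y.
(* This makes [(M + 1)^2] exceed [F] times the number [2 * E + 1] of possible shifts, which is
   linear in [M]. *)
pose M := (F * (4 * (kx + ky) + 2 * D + 1))%N.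
pose K := (M * (kx + ky))%N; pose E := (D + K)%N.
(* The three summands leave room before [m], from [m] to [b], and after [b]. *)
have [n hn] := unb ((E + 3) + (N + 2) + (2 * K + D + 1))%N.
pose elt (f : 'I_M.+1 * 'I_M.+1) := x ^+ f.1 * y ^+ f.2.
have pow z d j : dle d (Elt k 1) (Elt k z) -> dle (d * j) (Elt k 1) (Elt k (z ^+ j)).
  move=> zd; elim: j => [|j IH]; first exact: dle_refl.
  rewrite mulnS expgS; apply: dle_trans zd _.
  by have := dle_translate z IH; rewrite /= mulg1.
have eltK f : dle K (Elt k 1) (Elt k (elt f)).
  have := dle_translate (x ^+ f.1) (pow _ _ f.2 hy); rewrite /= mulg1.
  move=> /(dle_trans (pow _ _ f.1 hx)); apply: dle_leq; rewrite /K mulnDr.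
  by apply: leq_add; rewrite mulnC leq_mul2r -[_ <= M]ltnS ltn_ord orbT.
have eltC f : commute (elt f) g.
  by apply: commute_sym; apply: commuteM; apply: commuteX; apply: commute_sym.
have [dn hdn] := dle_total H S_gen 1 (g ^+ n).
have [p [l [gp p0 pl _]]] := geod_exists hdn.
have big : (E + 3) + (N + 2) + (2 * K + D + 1) < clength p 0 l.
  rewrite ltnNge; apply/negP => le; apply: hn; apply: dle_leq le _.
  by rewrite -p0 -pl; apply: dle_path (proj1 gp) _ _.
have El : E.+1 <= clength p 0 l by lia.
have [tm [m [tml pm /andP[tmX tmX']]]] := elt_at_depth (proj1 gp) p0 pl El.
have e1 := clengthD p (leq0n tm) tml.
pose p2 := vshift p tm; pose l2 := (l - tm)%N.
have gp2 : geod p2 l2 := geod_sub gp tml (leqnn l).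
have p20 : p2 0 = Elt k m by rewrite /p2 /vshift addn0.
have p2l : p2 l2 = Elt k (g ^+ n) by rewrite /p2 /vshift subnKC.
have len2 : clength p2 0 l2 = clength p tm l by rewrite clength_shift // addn0 subnKC.
have Nl : N <= clength p2 0 l2 by lia.
have [tb [b [tbl pb /andP[tbX tbX']]]] := elt_at_depth (proj1 gp2) p20 p2l Nl.
have e2 := clengthD p2 (leq0n tb) tbl.
have gnw (w : G) : commute w g -> w * g ^+ n = g ^+ n * w by move=> wg; apply: commuteX.
(* [i] encodes the shift [s - tm], of absolute value at most [E], as a natural number. *)
have near f : exists i : 'I_(2 * E).+1, exists s,
    [/\ s <= l, (tm + i = s + E)%N & dle D (Elt k (elt f * m)) (p s)].
  have q0d : dle K ((translate (elt f) \o p) 0) (p 0).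
    by rewrite /= p0 /= mulg1; apply: dle_sym.
  have qld : dle K ((translate (elt f) \o p) l) (p l).
    rewrite /= pl /= gnw //; apply: dle_sym.
    by have := dle_translate (g ^+ n) (eltK f); rewrite /= mulg1.
  have gq := geod_translate (elt f) gp.
  have [[s sl ds]|d|d] := thin_quadrilateral H_thin gp gq q0d qld tml.
  - have le1 : clength p tm l <= E + clength p s l.
      have := dle_trans (dle_trans ds (dle_path (proj1 gp) sl (leqnn _))) (dle_sym qld).
      by move=> /(geod_min gq tml (leqnn _)); rewrite clength_translate; lia.
    have le2 : clength p s l <= E + clength p tm l.
      have tl := dle_path (proj1 gq) tml (leqnn _); rewrite clength_translate in tl.
      have := dle_trans (dle_trans (dle_sym ds) tl) qld.
      by move=> /(geod_min gp sl (leqnn _)); lia.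
    have bd : tm <= s + E /\ s <= tm + E.
      case: (leqP s tm) => st.
        by have := clengthD p st tml; have := clength_size p st; lia.
      by have := clengthD p (ltnW st) sl; have := clength_size p (ltnW st); lia.
    have iP : s + E - tm < (2 * E).+1 by lia.
    exists (Ordinal iP), s; split=> //=; first by lia.
    by move: ds; rewrite /= pm.
  - by have := geod_min gq (leq0n _) tml (dle_sym d); rewrite clength_translate; lia.
  - by have := geod_min gq tml (leqnn _) d; rewrite clength_translate; lia.
have [pos hpos] := choice near.
have [|i hi] := @pigeonhole_fiber _ _ F pos.
  rewrite card_prod !card_ord.
  have -> : ((2 * E).+1 = 2 * D + 1 + 2 * M * (kx + ky))%N by rewrite /E /K; lia.
  rewrite /M; nia.
have [[f [f' [ne e]]]|inj] := EM (exists f f', f <> f' /\ elt f = elt f').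
  exists f.1, f.2, f'.1, f'.2; split=> //.
  by move=> [e3 e4]; apply: ne; case: f f' e3 e4 {e} => [? ?] [? ?] /= /val_inj -> /val_inj ->.
exfalso; have /card_gt0P[f0 f0A] : 0 < #|[pred f | pos f == i]| by apply: leq_ltn_trans hi.
(* All elements of the fiber bring [m] close to the same [p s], so these quotients move [m] by at
   most [2 * D]. *)
pose W := [seq (elt f0)^-1 * elt f | f <- enum [pred f | pos f == i]].
have uW : uniq W.
  rewrite map_inj_uniq ?enum_uniq // => f f' /mulgI e; apply: contrapT => ne.
  by apply: inj; exists f, f'.
have := hF p2 tb m b W (geod_take gp2 tbl) p20 pb.
rewrite tbX tbX' => /(_ isT uW) h; suff /h : {in W, forall w : G,
    dle eps (Elt k m) (Elt k (w * m)) /\ dle eps (Elt k b) (Elt k (w * b))}.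
  by rewrite size_map -cardE leqNgt hi.
move=> _ /mapP[f fA ->]; rewrite mem_enum inE in fA; rewrite inE in f0A.
have {fA f0A} ff : pos f = pos f0 by rewrite (eqP fA) (eqP f0A).
have [s [sl es ds]] := hpos f; have [s0 [s0l es0 ds0]] := hpos f0.
have {es es0} es : s0 = s by rewrite ff in es; lia.
rewrite {}es in ds0; set w := _^-1 * _.
have wC : commute w g.
  by apply: commute_sym; apply: commuteM; first apply: commuteV; apply: commute_sym.
have wm : dle (2 * D) (Elt k m) (Elt k (w * m)).
  have := dle_translate (elt f0)^-1 (dle_trans ds0 (dle_sym ds)).
  by rewrite /= mulKg mulgA addnn -mul2n.
have w1 : dle (2 * K) (Elt k 1) (Elt k w).
  have := dle_translate (elt f0)^-1 (dle_trans (dle_sym (eltK f0)) (eltK f)).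
  by rewrite /= mulVg addnn -mul2n.
split; first by apply: dle_leq wm; rewrite /eps; lia.
have gq := geod_translate w gp2.
have q0d : dle (2 * D) ((translate w \o p2) 0) (p2 0) by rewrite /= p20; apply: dle_sym.
have qld : dle (2 * K) ((translate w \o p2) l2) (p2 l2).
  rewrite /= p2l /= gnw //; apply: dle_sym.
  by have := dle_translate (g ^+ n) w1; rewrite /= mulg1.
have [[s' s'l ds']|d|d] := thin_quadrilateral H_thin gp2 gq q0d qld tbl; last 2 first.
- by have := geod_min gq (leq0n _) tbl (dle_sym d); rewrite clength_translate; lia.
- by have := geod_min gq tbl (leqnn _) d; rewrite clength_translate; lia.
have tl := dle_path (proj1 gq) (leq0n tb) tbl; rewrite clength_translate in tl.
have ps := dle_path (proj1 gp2) (leq0n s') s'l.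
have le1 := geod_min gp2 (leq0n _) s'l (dle_trans (dle_sym q0d) (dle_trans tl ds')).
have le2 := geod_min gq (leq0n _) tbl (dle_trans q0d (dle_trans ps (dle_sym ds'))).
rewrite clength_translate in le2.
(* By [le1] and [le2] the depths of [s'] and [tb] on [p2] differ by at most [3 * D]. *)
have bs : dle (3 * D) (p2 s') (p2 tb).
  case: (leqP s' tb) => st.
    apply: dle_leq (dle_path (proj1 gp2) st tbl).
    by have := clengthD p2 (leq0n s') st; lia.
  apply: dle_sym; apply: dle_leq (dle_path (proj1 gp2) (ltnW st) s'l).
  by have := clengthD p2 (leq0n tb) (ltnW st); lia.
have := dle_sym (dle_trans ds' bs); rewrite /= pb /=; apply: dle_leq.
by rewrite /eps; lia.
Qed.

End Acylindrical.

(** * Braid relations and reflections *)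

Section WordAction.
Variables (X : choiceType) (R : gword X -> gword X -> Prop) (T : Type).
Variables (f f' : X -> T -> T).
Hypotheses (fK : forall x, cancel (f x) (f' x)) (f'K : forall x, cancel (f' x) (f x)).

Definition letter_act (t : T) (a : X * bool) := if a.2 then f' a.1 t else f a.1 t.
Definition word_act (u : gword X) (t : T) := foldl letter_act t u.

Hypothesis fR : forall u v, R u v -> word_act u =1 word_act v.

Lemma word_act_cat u v t : word_act (u ++ v) t = word_act v (word_act u t).
Proof. exact: foldl_cat. Qed.

(** Bijections compatible with the relators define a right action of the presented group; words are
    read from left to right. *)
Lemma pres_eq_act u v : pres_eq R u v -> word_act u =1 word_act v.
Proof.
elim=> {u v} [u|u v _ uv|u v w _ uv _ vw|u x b v|u r s v rs] t //.
- by rewrite uv vw.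
- rewrite !word_act_cat; congr word_act.
  by case: b; rewrite /word_act /= /letter_act /= ?fK ?f'K.
- by rewrite !word_act_cat (fR rs).
Qed.

End WordAction.

Section PresClass.
Local Open Scope group_scope.
Variables (X : choiceType) (R : gword X -> gword X -> Prop).
Local Notation G := (presented_group R).
Local Notation cl := (pres_class R).

Definition gen (x : X) : G := cl [:: (x, false)].

Lemma pres_class_cat u v : cl (u ++ v) = cl u * cl v :> G.
Proof. exact/esym/pres_mulE. Qed.

Lemma pres_class_letter x b : cl [:: (x, b)] = (if b then (gen x)^-1 else gen x) :> G.
Proof.
case: b => //; apply: (mulgI (gen x)); rewrite mulgV -pres_class_cat.
apply/pres_classP; exact: (pres_cancel R [::] x false [::]).
Qed.

Lemma gen_exp x n : gen x ^+ n = cl (nseq n (x, false)).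
Proof. by elim: n => // n IH; rewrite expgS IH -pres_class_cat. Qed.

Lemma gen_ind (P : G -> Prop) : P 1 -> (forall x, P (gen x)) ->
  (forall a b, P a -> P b -> P (a * b)) -> (forall a, P a -> P a^-1) -> forall a, P a.
Proof.
move=> P1 Pg PM PV a; rewrite -(pres_classK a); elim: (repr a : gword X) => [|[x b] u IH] //.
by rewrite -cat1s pres_class_cat pres_class_letter; apply: PM => //; case: b; auto.
Qed.

End PresClass.

(** * Counting occurrences of a reflection along a word *)

Section ReflectionCounting.
Import GRing.Theory.
Local Open Scope ring_scope.
Variables (n : nat) (R : nzRingType) (s : 'I_n -> R).
Hypothesis ss : forall i, s i * s i = 1.

(** The classical action of a Coxeter group on signed reflections, with an integer counter in place
    of the sign; the generators then have infinite order. *)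
Definition count_act i (t : R * int) : R * int := (s i * t.1 * s i, t.2 + (t.1 == s i)%:Z).
Definition count_act' i (t : R * int) : R * int := (s i * t.1 * s i, t.2 - (t.1 == s i)%:Z).

Lemma conj_refl i r : s i * (s i * r * s i) * s i = r.
Proof. by rewrite !mulrA ss mul1r -mulrA ss mulr1. Qed.

Lemma conj_refl_eq i r : (s i * r * s i == s i) = (r == s i).
Proof.
apply/eqP/eqP => [e|->]; last by rewrite ss mul1r.
by rewrite -[LHS](conj_refl i) e ss mul1r.
Qed.

Lemma count_actK i : cancel (count_act i) (count_act' i).
Proof. by case=> r c; rewrite /count_act /count_act' /= conj_refl conj_refl_eq addrK. Qed.

Lemma count_act'K i : cancel (count_act' i) (count_act i).
Proof. by case=> r c; rewrite /count_act /count_act' /= conj_refl conj_refl_eq subrK. Qed.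

Fixpoint alt_prod (i j : 'I_n) k : R := if k is k'.+1 then s i * alt_prod j i k' else 1.
Fixpoint alt_prod_rev (i j : 'I_n) k : R := if k is k'.+1 then alt_prod_rev j i k' * s i else 1.

Lemma alt_prodV i j k : alt_prod_rev i j k * alt_prod i j k = 1.
Proof.
elim: k i j => [|k IH] i j /=; first by rewrite mul1r.
by rewrite -mulrA (mulrA (s i)) ss mul1r IH.
Qed.

Lemma alt_prod_swap i j k : alt_prod i j k * alt_prod_rev j i k = (s i * s j) ^+ k.
Proof.
elim: k i j => [|k IH] i j /=; first by rewrite mul1r.
rewrite mulrA -(mulrA (s i)) IH; elim: k {IH} => [|k IH]; first by rewrite mulr1.
by rewrite exprS !mulrA -(mulrA (s i * s j)) -(mulrA (s i * s j)) IH -exprS.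
Qed.

Lemma refl_expr i j l : s i * (s j * s i) ^+ l = (s i * s j) ^+ l * s i.
Proof.
elim: l => [|l IH]; first by rewrite mulr1 mul1r.
by rewrite !exprS -!mulrA -IH !mulrA.
Qed.

(** Undoing the first [l] conjugations turns the test at letter [l] into a comparison of the initial
    ring element with [(s i * s j) ^+ l * s i]. *)
Lemma word_act_alternating i j k t :
  word_act count_act count_act' (alternating i j k) t =
  (alt_prod_rev i j k * t.1 * alt_prod i j k,
   t.2 + \sum_(l < k) (t.1 == (s i * s j) ^+ l * s i)%:Z).
Proof.
elim: k i j t => [|k IH] i j [r c]; first by rewrite big_ord0 addr0 /= mul1r mulr1.
rewrite /word_act /= -/(word_act _ _ _ _) IH /= !mulrA; congr pair.
rewrite big_ord_recl expr0 mul1r addrA; congr (_ + _); apply: eq_bigr => l _.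
have -> : (s i * s j) ^+ bump 0 l * s i = s i * ((s j * s i) ^+ l * s j) * s i.
  by rewrite exprSr !mulrA refl_expr.
by congr (Posz (nat_of_bool _)); apply/eqP/eqP => [<-|->]; rewrite conj_refl.
Qed.

(** The two alternating products agree, and the reflections tested along the two words form the same
    list in opposite orders. *)
Lemma braid_count i j k : (s i * s j) ^+ k = 1 ->
  word_act count_act count_act' (alternating i j k) =1
  word_act count_act count_act' (alternating j i k).
Proof.
move=> ijk [r c]; rewrite !word_act_alternating.
have jik : (s j * s i) ^+ k = 1.
  by rewrite -[LHS]mul1r -{1}(ss i) -mulrA refl_expr ijk mul1r ss.
have ea : alt_prod i j k = alt_prod j i k.
  by rewrite -[LHS]mulr1 -(alt_prodV j i k) mulrA alt_prod_swap ijk mul1r.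
have er : alt_prod_rev i j k = alt_prod_rev j i k.
  by rewrite -[LHS]mulr1 -ijk -alt_prod_swap mulrA alt_prodV mul1r.
rewrite ea er; congr (_, _ + _).
rewrite (reindex_inj rev_ord_inj); apply: eq_bigr => l _ /=.
have key : (s i * s j) ^+ l.+1 * ((s j * s i) ^+ l * s j) = s i.
  elim: (l : nat) => [|h IH]; first by rewrite mul1r -mulrA ss mulr1.
  rewrite exprSr (exprS (s j * s i)) -!mulrA (mulrA (s j) (s j)) ss mul1r.
  by rewrite (mulrA (s i) (s i)) ss mul1r.
have -> // : (s i * s j) ^+ (k - l.+1) * s i = (s j * s i) ^+ l * s j.
by rewrite -[X in _ * X = _]key mulrA -exprD subnK // ijk mul1r.
Qed.

End ReflectionCounting.

(** * Reflections of the Tits representation *)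

Section TitsRepresentation.
Import GRing.Theory Num.Theory.
Local Open Scope ring_scope.

(** The polynomial [(X - 1)(X - t)(X - t^-1)] kills [u] and divides [X^k - 1]: its roots are [k]-th
    roots of unity, distinct because [k > 2]. *)
Lemma unity_root_expr (n : nat) (u : 'M[algC]_n.+1) k (t : algC) :
  (2 < k)%N -> k.-primitive_root t ->
  (u ^+ 2 - (t + t^-1) *: u + 1) * (u - 1) = 0 -> u ^+ k = 1.
Proof.
move=> k2 tk rel; have tk1 := prim_expr_order tk.
have t0 : t != 0.
  apply: contra_eq_neq tk1 => ->; rewrite expr0n eq_sym.
  by case: (k) k2 => // ? _; rewrite oner_eq0.
have tN j : (0 < j < k)%N -> t ^+ j != 1.
  by move=> /andP[j0 jk]; rewrite -(prim_order_dvd tk) gtnNdvd.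
pose p : {poly algC} := \prod_(a <- [:: 1; t; t^-1]) ('X - a%:P).
have pE : p = ('X^2 - (t + t^-1) *: 'X + 1) * ('X - 1).
  have e : t%:P * (t^-1)%:P = 1 :> {poly algC} by rewrite -polyCM divff.
  by rewrite /p !big_cons big_nil -mul_polyC polyCD -[X in (_ + X) * _]e polyC1; ring.
have /dvdpP [q eq] : p %| 'X^k - 1.
  apply: uniq_roots_dvdp.
    rewrite /= !rootE !hornerE exprVn tk1 expr1n invr1.
    by rewrite subrr eqxx.
  rewrite uniq_rootsE /= !inE !negb_or andbT.
  have t1 : t != 1 by have := tN 1%N; rewrite expr1; apply; lia.
  rewrite eq_sym t1 eq_sym invr_eq1 t1 /=.
  have := tN 2 k2; apply: contraNneq => e.
  by rewrite expr2 {2}e divff.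
have := congr1 (horner_mx u) eq.
rewrite rmorphM pE rmorphM !rmorphD !rmorphN /= linearZ /= !rmorphXn /= horner_mx_X !rmorph1.
by rewrite rel mulr0 => /eqP; rewrite subr_eq0 => /eqP.
Qed.

Variables (n' : nat).
Local Notation n := n'.+1.
Variable B : 'I_n -> 'I_n -> algC.
Hypothesis B2 : forall i, B i i = 2.

(** On column vectors [v], this is the rank-one map sending [v] to the product of row [i] of [B]
    with [v], times the [i]-th basis vector. *)
Definition root_mx i : 'M[algC]_n := \matrix_(a, b) ((a == i)%:R * B i b).
Definition refl_mx i : 'M[algC]_n := 1 - root_mx i.

Lemma root_mx_mul i j a b : (root_mx i * root_mx j) a b = (a == i)%:R * (B i j * B j b).
Proof.
rewrite mxE (bigD1 j) //= big1 ?addr0 => [|c /negPf cj]; last by rewrite !mxE cj mul0r mulr0.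
by rewrite !mxE eqxx mul1r mulrA.
Qed.

Lemma root_mx_sq i : root_mx i * root_mx i = 2 *: root_mx i.
Proof. by apply/matrixP => a b; rewrite root_mx_mul !mxE B2 mulrCA. Qed.

Lemma root_mx_braid i j : root_mx i * root_mx j * root_mx i = (B i j * B j i) *: root_mx i.
Proof.
apply/matrixP => a b; rewrite -mulrA mxE (bigD1 j) //= big1 ?addr0 => [|c /negPf cj].
  by rewrite root_mx_mul !mxE eqxx mul1r; move: (_%:R) => e; ring.
by rewrite root_mx_mul cj mul0r mulr0.
Qed.

Lemma root_mx_orth i j : B i j = 0 -> root_mx i * root_mx j = 0.
Proof. by move=> B0; apply/matrixP => a b; rewrite root_mx_mul mxE B0 mul0r mulr0. Qed.

Lemma refl_mx_sq i : refl_mx i * refl_mx i = 1.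
Proof.
rewrite /refl_mx mulrBl !mulrBr root_mx_sq !mul1r mulr1 scaler_nat mulr2n.
by rewrite opprB addrK subrK.
Qed.

Lemma refl_mx_neq i j : i != j -> refl_mx i != refl_mx j.
Proof.
move=> ij; apply: contra_neq (oner_neq0 algC) => /(can_inj (subKr 1)) /matrixP /(_ i i).
rewrite !mxE eqxx (negPf ij) mul0r mul1r B2 => /eqP.
by rewrite pnatr_eq0.
Qed.

Lemma refl_mx_comm i j : B i j = 0 -> B j i = 0 -> (refl_mx i * refl_mx j) ^+ 2 = 1.
Proof.
move=> ij ji; rewrite expr2; have c : refl_mx i * refl_mx j = refl_mx j * refl_mx i.
  rewrite /refl_mx !mulrBl !mulrBr !root_mx_orth // !mul1r !mulr1 !subr0.
  by rewrite -!addrA; congr (_ + _); rewrite addrC.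
by rewrite {2}c mulrA -(mulrA (refl_mx i)) refl_mx_sq mulr1 refl_mx_sq.
Qed.

(** With [u] the product of the reflections, [u + u^-1 - (t + t^-1)] kills both root matrices, and
    [u - 1] is a sum of terms each starting with one of them. So [u] satisfies the cubic equation of
    [unity_root_expr]. *)
Lemma refl_mx_order i j k (t : algC) : (2 < k)%N -> k.-primitive_root t ->
  B i j * B j i = 2 + t + t^-1 -> (refl_mx i * refl_mx j) ^+ k = 1.
Proof.
move=> k2 tk Bt; apply: unity_root_expr k2 tk _.
have refl_root h : refl_mx h * root_mx h = - root_mx h.
  by rewrite mulrBl mul1r root_mx_sq scaler_nat mulr2n opprD addNKr.
have cancel_root h l : B h l * B l h = 2 + t + t^-1 ->
    (refl_mx h * refl_mx l + refl_mx l * refl_mx h - (t + t^-1) *: 1) * root_mx h = 0.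
  move=> hl.
  have lh : refl_mx l * root_mx h = root_mx h - root_mx l * root_mx h by rewrite mulrBl mul1r.
  have hlh : refl_mx h * (root_mx l * root_mx h) =
      root_mx l * root_mx h - (2 + t + t^-1) *: root_mx h.
    by rewrite mulrBl mul1r mulrA root_mx_braid hl.
  rewrite mulrBl mulrDl -!mulrA refl_root lh mulrBr refl_root hlh mulrN lh -scalerAl mul1r.
  move: (root_mx l * root_mx h) (root_mx h) => P E.
  by apply/matrixP => a b; rewrite !mxE; ring.
set u := refl_mx i * refl_mx j; set v := refl_mx j * refl_mx i.
have uv : u * v = 1 by rewrite /u /v mulrA -(mulrA (refl_mx i)) refl_mx_sq mulr1 refl_mx_sq.
pose Q := u + v - (t + t^-1) *: 1.
have -> : u ^+ 2 - (t + t^-1) *: u + 1 = u * Q.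
  by rewrite /Q mulrBr mulrDr uv -expr2 -scalerAr mulr1 addrAC.
have -> : u - 1 = root_mx i * root_mx j - root_mx i - root_mx j.
  rewrite /u /refl_mx mulrBl !mulrBr !mul1r !mulr1.
  move: (root_mx i * root_mx j) (root_mx i) (root_mx j) => P E F.
  by apply/matrixP => a b; rewrite !mxE; ring.
have Qi : Q * root_mx i = 0 by apply: cancel_root.
have Qj : Q * root_mx j = 0 by rewrite /Q (addrC u); apply: cancel_root; rewrite mulrC.
by rewrite -mulrA 2!(mulrBr Q) (mulrA Q) Qi Qj mul0r !subr0 mulr0.
Qed.

End TitsRepresentation.

(** * Artin groups *)

Section ArtinGroups.
Import GRing.Theory Num.Theory.
Local Open Scope ring_scope.

Lemma coxeter_representation n (m : 'I_n.+1 -> 'I_n.+1 -> option nat) : artin_labels m ->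
  exists s : 'I_n.+1 -> 'M[algC]_n.+1, [/\ forall i, s i * s i = 1,
    forall i j, i != j -> s i != s j &
    forall i j k, i != j -> m i j = Some k -> (s i * s j) ^+ k = 1].
Proof.
move=> m_labels; have root k : exists t : algC, (0 < k)%N -> k.-primitive_root t.
  case: k => [|k]; first by exists 0.
  by have [t ht] := C_prim_root_exists (ltn0Sn k); exists t.
have [t ht] := choice root.
(* Only the product 2 + t + t^-1 = 4 cos^2 (pi / k) of B i j and B j i matters, so
   that B is not taken symmetric. *)
pose B i j : algC := if i == j then 2 else match m i j with
  | Some 2 => 0
  | Some k => if (i < j)%N then 1 else 2 + t k + (t k)^-1
  | None => 0 end.
have B2 i : B i i = 2 by rewrite /B eqxx.
exists (refl_mx B); split=> [i|i j|i j k ij mij]; [exact: refl_mx_sq|exact: refl_mx_neq|].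
have [mji k2] := m_labels i j ij; have {}k2 := k2 _ mij.
have BE : B i j = if k == 2 then 0 else if (i < j)%N then 1 else 2 + t k + (t k)^-1.
  by rewrite /B (negPf ij) mij; case: (k) k2 => [|[|[|]]].
have BE' : B j i = if k == 2 then 0 else if (j < i)%N then 1 else 2 + t k + (t k)^-1.
  by rewrite /B eq_sym (negPf ij) -mji mij; case: (k) k2 => [|[|[|]]].
have [e|k3] := eqVneq k 2.
  by rewrite e in BE BE' *; apply: refl_mx_comm.
apply: (@refl_mx_order _ _ B2 _ _ _ (t k)); [lia|by apply: ht; lia|].
rewrite BE BE' (negPf k3); case: (ltngtP i j) => [_|_|/val_inj e].
- by rewrite mul1r.
- by rewrite mulr1.
- by rewrite e eqxx in ij.
Qed.

Variables (n : nat) (m : 'I_n -> 'I_n -> option nat).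
Hypothesis m_labels : artin_labels m.
Local Notation A := (artin_group m).
Local Notation R := (artin_relation m).
Local Notation x := (gen R).

(** Acting on [(s i, 0)], [x i] fixes the reflection and raises the counter each time. Under powers
    of [x j] the first entry never becomes [s j], so the counter stays 0. *)
Lemma gen_exp_neq i j N : (0 < N)%N -> i != j -> (x i ^+ N <> x j ^+ N :> A)%g.
Proof.
move=> N0 ij; case: n m m_labels i j ij => [|n'] m' m_lab i j ij; first by case: i ij.
have [s [ss sI sB]] := coxeter_representation m_lab.
rewrite !gen_exp => /pres_classP.
have fR u v : artin_relation m' u v ->
    word_act (count_act s) (count_act' s) u =1 word_act (count_act s) (count_act' s) v.
  move=> [a [b [k [ab mab -> ->]]]]; apply: braid_count => //.
  exact: sB mab.
move=> /(pres_eq_act (count_actK ss) (count_act'K ss) fR) /(_ (s i, 0)).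
have pow h a c : word_act (count_act s) (count_act' s) (nseq a (h, false)) (s i, c) =
    (iter a (fun r => s h * r * s h) (s i), c + if h == i then a%:Z else 0).
  have hit r : (r == s h) = (s h * r * s h == s h) by rewrite conj_refl_eq.
  suff E r : (r == s h) = (h == i) ->
    word_act (count_act s) (count_act' s) (nseq a (h, false)) (r, c) =
    (iter a (fun r => s h * r * s h) r, c + if h == i then a%:Z else 0).
    apply: E; rewrite eq_sym; have [->|/sI/negPf->//] := eqVneq h i; first by rewrite eqxx.
  elim: a r c => [|a IH] r c rh; first by rewrite /= if_same addr0.
  rewrite /word_act /= -/(word_act _ _ _ _) /letter_act /count_act /= IH; last by rewrite -hit.
  rewrite -iterSr rh; case: (h == i); last by rewrite !addr0.
  by congr (_, _); lia.
by rewrite !pow eqxx (eq_sym j) (negPf ij) => -[_]; lia.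
Qed.

Definition letter_sign (a : 'I_n * bool) : int := if a.2 then -1 else 1.
(** The exponent sum; it descends to a homomorphism from the Artin group to the integers because
    braid relations are homogeneous. *)
Definition word_length (u : gword 'I_n) : int := \sum_(a <- u) letter_sign a.

Lemma word_length_alternating i j k : word_length (alternating i j k) = k.
Proof.
elim: k i j => [|k IH] i j; first by rewrite /word_length big_nil.
by rewrite /word_length big_cons -/(word_length _) IH /letter_sign /=; lia.
Qed.

Lemma pres_eq_length u v : pres_eq R u v -> word_length u = word_length v.
Proof.
elim=> {u v} // [u v w _ -> _ -> //|u i b v|u r s v [i [j [k [_ _ -> ->]]]]].
  rewrite /word_length !big_cat !big_cons big_nil /letter_sign /=.
  by case: b => /=; congr (_ + _); rewrite ?addr0 ?addrA ?subrr ?addNr ?add0r.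
by rewrite /word_length !big_cat /= -!/(word_length _) !word_length_alternating.
Qed.

Definition artin_length (a : A) : int := word_length (repr a).

Lemma artin_length_class u : artin_length (pres_class R u) = word_length u.
Proof. exact/pres_eq_length/pres_repr. Qed.

Lemma artin_lengthM a b : artin_length (a * b)%g = artin_length a + artin_length b.
Proof.
rewrite -(pres_classK a) -(pres_classK b) -[(_ * _)%g]pres_class_cat !artin_length_class.
by rewrite /word_length big_cat.
Qed.

Lemma artin_length1 : artin_length 1%g = 0.
Proof. by have := artin_lengthM 1%g 1%g; rewrite mulg1; lia. Qed.

Lemma artin_lengthV a : artin_length a^-1%g = - artin_length a.
Proof. by have := artin_lengthM a^-1%g a; rewrite mulVg artin_length1; lia. Qed.

Lemma artin_lengthX a k : artin_length (a ^+ k)%g = artin_length a *+ k.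
Proof.
elim: k => [|k IH]; first by rewrite artin_length1.
by rewrite expgS artin_lengthM IH mulrS.
Qed.

Lemma artin_length_gen i : artin_length (x i) = 1.
Proof. by rewrite artin_length_class /word_length big_seq1. Qed.

Lemma artin_infinite_order (a : A) : artin_length a != 0 -> infinite_order a.
Proof.
move=> a0 r r0 e; have := artin_lengthX a r; rewrite e artin_length1 => /esym/eqP.
by rewrite mulrn_eq0 (negPf a0) orbF; lia.
Qed.

Definition int_exp (a : A) (k : int) : A :=
  match k with Posz h => (a ^+ h)%g | Negz h => (a ^- h.+1)%g end.

Lemma int_expS a k : int_exp a (1 + k) = (a * int_exp a k)%g.
Proof.
case: k => [h|[|h]].
- have -> : 1 + Posz h = h.+1 by lia.
  by rewrite /= expgS.
- by rewrite /= mulgV.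
- have -> : 1 + Negz h.+1 = Negz h by lia.
  by rewrite /= (expgSr _ h.+1) invgM mulVKg.
Qed.

(** For a single generator, the exponent sum is inverse to taking powers of it. *)
Lemma artin_one_generator : n = 1%N -> isomorphic_to_int A.
Proof.
move=> n1; have i0 : 'I_n by rewrite n1; exact: ord0.
have ai0 i : i = i0 by apply/val_inj; case: i i0 => [? ?] [? ?] /=; lia.
exists artin_length; last exact: artin_lengthM.
exists (int_exp (x i0)) => [a|[h|h]]; last first.
- by rewrite /= artin_lengthV artin_lengthX artin_length_gen; lia.
- by rewrite /= artin_lengthX artin_length_gen; lia.
rewrite -(pres_classK a) artin_length_class.
elim: (repr a : gword _) => [|[i b] u IH]; first by rewrite /word_length big_nil.
rewrite -cat1s pres_class_cat pres_class_letter -[in RHS]IH /word_length big_cat big_seq1 /=.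
rewrite -/(word_length u) /letter_sign /= (ai0 i); case: b; last exact: int_expS.
by apply: (mulgI (x i0)); rewrite mulVKg -int_expS; congr int_exp; lia.
Qed.

Local Open Scope group_scope.

Fixpoint alt_elt (i j : 'I_n) k : A := if k is k'.+1 then x i * alt_elt j i k' else 1.

Lemma alt_elt_class i j k : alt_elt i j k = pres_class R (alternating i j k).
Proof. by elim: k i j => //= k IH i j; rewrite IH -pres_class_cat. Qed.

Lemma alt_eltSr i j k : alt_elt i j k.+1 = alt_elt i j k * x (if odd k then j else i).
Proof.
elim: k i j => [|k IH] i j; first by rewrite /= mul1g mulg1.
by rewrite -[LHS]/(x i * alt_elt j i k.+1) IH mulgA /=; case: (odd k).
Qed.

(** Conjugation by the alternating element fixes [x i] and [x j] when [k] is even and swaps them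
    when [k] is odd. *)
Lemma braid_square_commute i j k : i != j -> m i j = Some k ->
  commute (x i) (alt_elt i j k * alt_elt i j k) /\
  commute (x j) (alt_elt i j k * alt_elt i j k).
Proof.
move=> ij mij; have e : alt_elt i j k = alt_elt j i k.
  rewrite !alt_elt_class; apply/pres_classP.
  have := @pres_rel _ R [::] (alternating i j k) (alternating j i k) [::].
  by rewrite !cats0; apply; exists i, j, k.
have ei : x i * alt_elt i j k = alt_elt i j k * x (if odd k then j else i).
  by rewrite -alt_eltSr e.
have ej : x j * alt_elt i j k = alt_elt i j k * x (if odd k then i else j).
  by rewrite [in RHS]e -alt_eltSr.
rewrite /commute !mulgA ei ej; case: (odd k) ei ej => ei ej.
  by rewrite -!mulgA ei ej.
by rewrite -!mulgA ei ej.
Qed.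

Lemma braid_square_length i j k :
  artin_length (alt_elt i j k * alt_elt i j k) = (2 * k)%N.
Proof.
by rewrite artin_lengthM alt_elt_class artin_length_class word_length_alternating; lia.
Qed.

Hypothesis m_connected : artin_graph_connected m.

Lemma artin_not_relatively_hyperbolic : (1 < n)%N -> ~ relatively_hyperbolic A.
Proof.
move=> n2 [k [H [Hsub [S [S_gen [delta thin_delta] bcp]]]]].
have Hc i := proj1 (proj1 (Hsub i)).
have gen_inf i : infinite_order (x i : A) by apply: artin_infinite_order; rewrite artin_length_gen.
pose z i j c : A := alt_elt i j c * alt_elt i j c.
have zP i j c : i != j -> m i j = Some c ->
    [/\ commute (x i) (z i j c), commute (x j) (z i j c) & infinite_order (z i j c)].
  move=> ij mij; have [ci cj] := braid_square_commute ij mij; split=> //.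
  have [_ /(_ _ mij) c2] := m_labels ij.
  by apply: artin_infinite_order; rewrite braid_square_length; lia.
(* The first edge of a path between two distinct vertices. *)
have [a [b [c [ab mab]]]] : exists a b c, a != b /\ m a b = Some c.
  have a : 'I_n by exact: Ordinal (ltnW n2).
  have [b ba] : exists b : 'I_n, b != Ordinal (ltnW n2) by exists (Ordinal n2).
  have /connectP[[|b' p]] := m_connected (Ordinal (ltnW n2)) b.
    by move=> _ e; rewrite e eqxx in ba.
  move=> /= /andP[/andP[ne mne] _] _; exists (Ordinal (ltnW n2)), b'.
  by case: (m _ b') mne => // c _; exists c.
have [ca cb zinf] := zP _ _ _ ab mab.
case: (EM (exists D, forall r, cdist_le S H D (Elt k 1) (Elt k (z a b c ^+ r)))) => [[D hD]|unb].
  have [i [h [r [r0 zH]]]] := bounded_orbit_parabolic Hc S_gen bcp zinf hD.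
  have zr_inf : infinite_order (z a b c ^+ r).
    by move=> q q0; rewrite -expgnA; apply: zinf; rewrite muln_gt0 r0.
  pose P (y : A) := H i (h^-1 * y * h).
  have Pa : P (x a).
    by apply: (commute_parabolic Hc S_gen bcp zr_inf zH); apply: commuteX.
  (* Along each edge, [P] passes from one generator to the braid square, and from there to the other
     generator. *)
  have Pgen d : P (x d).
    have /connectP[p] := m_connected a d.
    elim: p a Pa {ca cb zinf zH zr_inf ab mab hD} => [|e p IH] a Pa /=; first by move=> _ ->.
    move=> /andP[/andP[ae mae] pp] dl; apply: (IH e) => //.
    case mE : (m a e) mae => [f|//] _; have [fa fe finf] := zP _ _ _ ae mE.
    have Pz : P (z a e f).
      by apply: (commute_parabolic Hc S_gen bcp (@gen_inf a) Pa); apply: commute_sym.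
    exact: (commute_parabolic Hc S_gen bcp finf Pz).
  have [H1 _] := Hc i; have HM := group_closedM (Hc i); have HV := group_closedV (Hc i).
  have Pall : forall y, P y.
    apply: gen_ind => //; rewrite /P.
    - by rewrite mulg1 mulVg; apply: set_mem.
    - move=> y y' Py Py'; have -> : h^-1 * (y * y') * h = (h^-1 * y * h) * (h^-1 * y' * h).
        by rewrite !mulgA mulgK.
      by apply: set_mem; apply: HM; apply: mem_set.
    - move=> y Py; have -> : h^-1 * y^-1 * h = (h^-1 * y * h)^-1.
        by rewrite !invgM invgK mulgA.
      by apply: set_mem; apply: HV; apply: mem_set.
  apply: (proj2 (Hsub i)); apply/seteqP; split=> // y _.
  by have := Pall (h * y * h^-1); rewrite /P !mulgA mulVg mul1g mulgVK.
have {}unb d : exists r, ~ cdist_le S H d (Elt k 1) (Elt k (z a b c ^+ r)).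
  by apply: contrapT => /forallNP nb; apply: unb; exists d => r; apply: contrapT (nb r).
have [i [j [i' [j' [ne e]]]]] :=
  unbounded_orbit_centraliser S_gen bcp thin_delta unb ca cb.
(* Comparing exponent sums gives [j' - j = i - i']; cancelling common powers then yields an equality
   of equal powers of [x a] and [x b]. *)
wlog ii : i j i' j' ne e / (i' <= i)%N => [hw|].
  by case: (leqP i' i) => [/(hw i j i' j')|/ltnW /(hw i' j' i j)]; apply=> // /esym.
have := congr1 artin_length e; rewrite !artin_lengthM !artin_lengthX !artin_length_gen => len.
have jj : j' = (j + (i - i'))%N by lia.
apply: (@gen_exp_neq a b (i - i')) => //.
  by rewrite subn_gt0 ltn_neqAle ii andbT; apply/eqP => ei; apply: ne; rewrite jj ei subnn addn0.
move: e; rewrite -{1}(subnKC ii) expgnDr -mulgA => /mulgI; rewrite jj addnC expgnDr.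
by move=> /mulIg.
Qed.

End ArtinGroups.

Theorem proposition1p3 (n : nat) (m : 'I_n -> 'I_n -> option nat)
    (n_ge1 : 1 <= n) (m_labels : artin_labels m)
    (m_connected : artin_graph_connected m)
    (A_not_Z : ~ isomorphic_to_int (artin_group m)) :
  ~ relatively_hyperbolic (artin_group m).
Proof.
case: (leqP n 1) => n1; last exact: artin_not_relatively_hyperbolic.
by case: A_not_Z; apply: artin_one_generator; lia.
Qed.
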